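(* Let $G$ be a finite matchstick graph with $n\geq 1$ vertices and no isolated vertices (i.e. no vertices of degree $0$). For each $i$, let $n_i$ be the number of vertices of $G$ of degree exactly $i$. Then $$4n_1+3n_2+2n_3+n_4 > \sqrt{\pi\sqrt{3}\cdot n}.$$
   Context: A matchstick graph is a finite simple graph drawn in the Euclidean plane such that the vertices are distinct points, each edge $uv$ is the straight-line segment joining $u$ and $v$ and has length exactly $1$, and distinct edges intersect only at (common) endpoints. The graph is not assumed to be connected, and vertices of any degree $\geq 1$ are allowed. *)

(* Defs.v *)
From HB Require Import structures.
From mathcomp Require Import all_boot all_order all_algebra.
From mathcomp Require Import reals trigo.

Set Implicit Arguments.
Unset Strict Implicit.
Unset Printing Implicit Defensive.

Import Order.TTheory GRing.Theory Num.Theory.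
Local Open Scope ring_scope.

(* The norm that MathComp-Analysis puts on row vectors is the sup norm, hence *)
(* the explicit Euclidean distance.                                           *)
Definition edist (R : realType) (a b : 'rV[R]_2) : R :=
  Num.sqrt (\sum_(i < 2) (a 0 i - b 0 i) ^+ 2).

Definition in_segment (R : realType) (a b z : 'rV[R]_2) : Prop :=
  exists t : R, 0 <= t <= 1 /\ z = (1 - t) *: a + t *: b.

Record simple_graph (T : finType) (e : rel T) : Prop := SimpleGraph {
  adj_sym : symmetric e;
  adj_irr : irreflexive e }.

(* An edge is the unordered pair [set u; v] with e u v, so two adjacent pairs *)
(* (u, v) and (x, y) are distinct edges when these sets differ.               *)
Record matchstick_graph (R : realType) (T : finType) (e : rel T)
    (p : T -> 'rV[R]_2) : Prop := MatchstickGraph {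
  matchstick_simple : simple_graph e;
  matchstick_inj : injective p;
  matchstick_unit : forall u v : T, e u v -> edist (p u) (p v) = 1;
  matchstick_cross : forall (u v x y : T) (z : 'rV[R]_2),
    e u v -> e x y -> [set u; v] != [set x; y] ->
    in_segment (p u) (p v) z -> in_segment (p x) (p y) z ->
    exists2 w : T, w \in [set u; v] :&: [set x; y] & z = p w }.

Definition degree (T : finType) (e : rel T) (v : T) : nat :=
  #|[set w | e v w]|.

Definition ndeg (T : finType) (e : rel T) (i : nat) : nat :=
  #|[set v | degree e v == i]|.

(* Main.v *)
Require Import Defs.
From HB Require Import structures.
From mathcomp Require Import all_boot all_order all_algebra zify ring lra.
From mathcomp Require Import reals trigo.

Set Implicit Arguments.
Unset Strict Implicit.
Unset Printing Implicit Defensive.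

(* Rotate the drawing so that no two vertices share an abscissa, and let S be the sum *)
(* over the vertices of max(0, 5 - degree), that is 4 n_1 + 3 n_2 + 2 n_3 + n_4. Let L *)
(* be the number of darts (oriented edges) bordering the unbounded region.             *)
(* - S >= L: cut the turn around each vertex by six equally spaced directions, and     *)
(*   charge each corner of a region (number of directions in it) - 1 - [this number    *)
(*   is at least 2]. The charges at v sum to at most max(0, 5 - degree v), as one of   *)
(*   at most 5 corners contains two of the six directions. A bounded region with k     *)
(*   darts contains at least 3k - 6 directions, the unbounded one at least 3k; so the  *)
(*   total charge is nonnegative on bounded regions (k <= 4 is settled by the shape of *)
(*   unit triangles and rhombi) and at least L on the unbounded one.                   *)
(* - There are at least n + L - S bounded triangles, by the Euler inequality.          *)
(* - Each has area sqrt 3 / 4, and by the isoperimetric inequality their total area is *)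
(*   less than L^2 / (4 pi). Hence pi sqrt 3 (n + L - S) < L^2, and S >= L concludes.  *)
(* The one topological input, that a bounded region with k darts contains at least     *)
(* k - 2 upward or downward directions, comes from a vertical sweep: a connected graph *)
(* has at most one vertex more than it has edges.                                      *)


(** Three numbers are compared: the deficit S, the number L of outer darts and the number t of
    bounded unit triangles. If S is small against n, then t is large, and an outer boundary of only
    L <= S unit darts has to enclose the area of all these triangles. [Sweep.outer_le_deficit] gives
    L <= S, [Sweep.many_triangles] gives t >= n + L - S, [isoperimetric] bounds the area, and
    [plane_bounds] gathers them. Both combinatorial estimates rest on one count. For a region with k
    darts, r of them rightward, and u vertices whose upward direction lies in it, [Sweep.mu_face]
    finds exactly 3k + 6(u - r) sextant boundaries in its corners, while [Sweep.face_card] gives r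
    <= u + 1, and r <= u for the unbounded region. This stands for the angle sum of a polygon and
    for Euler's formula, whether or not the boundary of the region is connected. With c = pi sqrt 3,
    the bounds give c n < L^2 + c (S - L), and the right side is at most S^2 when L = S or S + L >=
    c. The few remaining cases are excluded by [small_deficit], because a simple graph on few
    vertices has a large deficit. *)

Lemma connected_card (N E : finType) (l r : E -> N) (C : {set N}) (x0 : N) :
  x0 \in C ->
  (forall A : {set N}, A \subset C -> x0 \in A ->
     (forall v, l v \in C -> r v \in C -> (l v \in A) = (r v \in A)) -> A = C) ->
  #|C| <= #|[set v | (l v \in C) && (r v \in C)]|.+1.
Proof.
move=> x0C conn.
pose inner (A : {set N}) := [set v | (l v \in A) && (r v \in A)].
pose good (A : {set N}) := [&& A \subset C, x0 \in A & #|A| <= #|inner A|.+1].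
have good1 : good [set x0] by rewrite /good sub1set x0C set11 cards1.
have [A /maxsetP[/and3P[AC x0A cA] maxA] _] := maxset_exists good1.
have inner_lt (B : {set N}) v : A \subset B -> (l v \in B) && (r v \in B) ->
    ~~ ((l v \in A) && (r v \in A)) -> #|inner A| < #|inner B|.
  move=> AB vB vA; apply: proper_card; apply/properP; split; last by exists v; rewrite inE.
  by apply/subsetP=> w; rewrite !inE => /andP[/(subsetP AB)-> /(subsetP AB)->].
have grow x v : x \in C -> x \notin A ->
    (l v \in x |: A) && (r v \in x |: A) ->
    ~~ ((l v \in A) && (r v \in A)) -> False.
  move=> xC xA vB vA; have AB : A \subset x |: A := subsetUr _ _.
  suff gB : good (x |: A) by move: xA; rewrite -(maxA _ gB AB) setU11.
  rewrite /good subUset sub1set xC AC in_setU x0A orbT cardsU1 xA /=.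
  by rewrite add1n ltnS (leq_trans cA) // (inner_lt _ v).
rewrite -(conn A) // => v lC rC; apply/idP/idP => vA; apply/negPn/negP => nvA.
  by apply: (grow (r v) v) => //; rewrite ?inE ?eqxx ?vA ?orbT ?(negPf nvA).
by apply: (grow (l v) v) => //; rewrite ?inE ?eqxx ?vA ?orbT ?(negPf nvA).
Qed.

(** * Sequences, and averages over the orbits of an injection *)

Lemma path_zip (T : eqType) (r : rel T) x s :
  path r x s = all (fun p => r p.1 p.2) (zip (x :: s) s).
Proof. by elim: s x => //= y s IHs x; rewrite IHs. Qed.

Lemma path_zipT (T : eqType) (r : rel T) x s :
  (forall y z, (y, z) \in zip (x :: s) s -> r y z) -> path r x s.
Proof. by move=> H; rewrite path_zip; apply/allP=> -[y z] /H. Qed.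

Lemma sub_path_zip (T : eqType) (r : rel T) x s y z :
  path r x s -> (y, z) \in zip (x :: s) s -> r y z.
Proof. by rewrite path_zip => /allP H /H. Qed.

Lemma next_fixed (T : eqType) (s : seq T) x :
  uniq s -> x \in s -> next s x = x -> s = [:: x].
Proof.
move=> us xs; have [i s' def_s] := rot_to xs.
rewrite -(next_rot i us) def_s; case: s' def_s => [|y s'] def_s /=.
  move=> _; move: (congr1 size def_s) xs; rewrite size_rot.
  by case: s {us def_s} => [|y [|]] //= _; rewrite inE => /eqP->.
rewrite eqxx => yx; have := us; rewrite -(rot_uniq i) def_s /= -yx.
by rewrite inE eqxx.
Qed.

Lemma prev_head (T : eqType) (s : seq T) x : x \notin s -> prev (x :: s) x = last x s.
Proof.
rewrite /=; suff H y : x \notin s -> prev_at x x y s = last y s by exact: H.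
elim: s y => [|z s IHs] y /=; first by rewrite eqxx.
by rewrite inE negb_or => /andP[/negPf-> /IHs].
Qed.

Lemma orbit_sum (V : nmodType) (D : finType) (f : D -> D) (G : D -> V) d :
  (\sum_(j < order f d) G (iter j f d) = \sum_(x | fconnect f d x) G x)%R.
Proof.
rewrite -(eq_bigl _ _ (fun x => esym (fconnect_orbit f d x))) -big_uniq ?orbit_uniq //=.
rewrite /orbit (big_nth d) size_traject big_mkord; apply: eq_bigr => j _.
by rewrite nth_traject.
Qed.

(** Reduces a sum over a region to its boundary orbits without choosing representatives: each
    element receives the mean of its own orbit. *)
Lemma orbit_average (F : numFieldType) (D : finType) (f : D -> D) (P : pred D) (G : D -> F) :
  injective f -> (forall d, P (f d) = P d) ->
  (\sum_(d | P d) G d =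
   \sum_(d | P d) (\sum_(j < order f d) G (iter j f d)) / (order f d)%:R)%R.
Proof.
move=> f_inj Pf; have symf := fconnect_sym f_inj.
have Pc d x : fconnect f d x -> P x = P d.
  by move/iter_findex=> <-; elim: (findex f d x) => //= k <-; rewrite Pf.
under [RHS]eq_bigr => d _ do rewrite orbit_sum GRing.mulr_suml.
rewrite (exchange_big_dep P) /=; last by move=> d x Pd /Pc ->.
apply: eq_bigr => x Px; rewrite (eq_bigr (fun=> G x / (order f x)%:R)%R); last first.
  by move=> d /andP[_ dx]; rewrite /order (eq_card (same_connect symf dx)).
rewrite (eq_bigl (fconnect f x)) => [|d]; last first.
  by apply/andP/idP=> [[_]|xd]; [rewrite symf | rewrite (Pc _ _ xd) symf].
rewrite GRing.sumr_const -(GRing.mulr_natr (G x / _)%R) -/(order f x) -GRing.mulrA.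
rewrite GRing.mulVf ?GRing.mulr1 //.
by rewrite Num.Theory.pnatr_eq0 -lt0n order_gt0.
Qed.

(** * Regions of a vertical sweep *)

Module Sweep.

Section Faces.

(* Vertices are numbered by increasing abscissa, [D] is the set of darts, [tw] reverses *)
(* a dart, [rt] selects the darts directed to the right and [tl] is the starting vertex. *)
(* Edges are represented by their rightward dart. On the vertical line through [v], the *)
(* lists [bl v] and [ab v] contain the edges crossing below and above [v], while [lf v] *)
(* and [rg v] contain the edges ending at [v] from the left and from the right, all of *)
(* them from bottom to top; [slabS] compares both descriptions of the slab between two *)
(* consecutive vertices. *)
Variables (n : nat) (D : finType) (tw : D -> D) (rt : pred D) (tl : D -> 'I_n).
Variables (bl lf rg ab : 'I_n -> seq D).
Let hd d := tl (tw d).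

Hypothesis twK : involutive tw.
Hypothesis rt_tw : forall d, rt (tw d) = ~~ rt d.
Hypothesis mem_lf : forall v d, (d \in lf v) = rt d && (hd d == v).
Hypothesis mem_rg : forall v d, (d \in rg v) = rt d && (tl d == v).
Hypothesis rt_bl : forall v, all rt (bl v).
Hypothesis uniq_lf : forall v, uniq (lf v).
Hypothesis uniq_slab : forall v, uniq (bl v ++ rg v ++ ab v).
Hypothesis slab0 : forall v : 'I_n, v = 0 :> nat -> bl v ++ lf v ++ ab v = [::].
Hypothesis slabS : forall v w : 'I_n, w = v.+1 :> nat ->
  bl v ++ rg v ++ ab v = bl w ++ lf w ++ ab w.
Hypothesis no_isolated : forall v, lf v ++ rg v != [::].

Definition slab v : seq (option D) := rcons (map Some (bl v ++ rg v ++ ab v)) None.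
Definition lslab v : seq (option D) := rcons (map Some (bl v ++ lf v ++ ab v)) None.
(* [cyc v] lists the darts leaving [v] counterclockwise from the upward direction, and *)
(* [nxt] follows the boundary of the region on the left of a dart. *)
Definition cyc v := rev (map tw (lf v)) ++ rg v.
Definition nxt a := prev (cyc (hd a)) (tw a).
Definition up v := last None (map Some (cyc v)).
Definition lend v := last None (map Some (bl v ++ lf v)).
Definition rend v := last None (map Some (bl v ++ rg v)).

(* A dart stands for the region on its left and [None] for the unbounded region. In a *)
(* slab, two consecutive edges border a common region, from above and from below. The *)
(* graph need not be connected, so that a region can be bordered by several orbits of *)
(* [nxt]. *)
Definition glue : rel (option D) := fun x y =>
  [exists a, (x == Some a) && (y == Some (nxt a))]
  || [exists v, (x, omap tw y) \in zip (None :: slab v) (slab v)].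
Definition face := fingraph.root (relU glue (fun x y => glue y x)).

Lemma otwK : involutive (omap tw).
Proof. by case=> //= d; rewrite twK. Qed.

Lemma uniq_rg v : uniq (rg v).
Proof. by have := uniq_slab v; rewrite !cat_uniq => /and3P[_ _ /and3P[]]. Qed.

Lemma uniq_cyc v : uniq (cyc v).
Proof.
rewrite cat_uniq rev_uniq map_inj_uniq ?uniq_lf ?uniq_rg ?andbT //=; last exact: inv_inj.
apply/hasPn=> d; rewrite mem_rg mem_rev => /andP[rd _].
apply/mapP=> -[d']; rewrite mem_lf => /andP[rd' _] dd'.
by move: rd; rewrite dd' rt_tw rd'.
Qed.

Lemma mem_cyc v d : (d \in cyc v) = (tl d == v).
Proof.
rewrite mem_cat mem_rev mem_rg -{1}[d]twK mem_map; last exact: inv_inj.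
by rewrite mem_lf rt_tw /hd twK; case: (rt d) => /=; rewrite ?orbF.
Qed.

Lemma tl_nxt d : tl (nxt d) = hd d.
Proof. by apply/eqP; rewrite -mem_cyc mem_prev mem_cyc. Qed.

Lemma next_nxt a : next (cyc (tl (nxt a))) (nxt a) = tw a.
Proof. by rewrite tl_nxt /nxt next_prev ?uniq_cyc. Qed.

Lemma nxt_inj : injective nxt.
Proof. by move=> a b ab'; apply: (inv_inj twK); rewrite -!next_nxt ab'. Qed.

Lemma connect_face_sym : connect_sym (relU glue (fun x y => glue y x)).
Proof. by apply: sym_connect_sym => x y; rewrite /relU /= orbC. Qed.

Lemma glue_face x y : glue x y -> face x = face y.
Proof.
move=> gxy; apply/eqP; rewrite (root_connect connect_face_sym).
by apply: connect1; rewrite /= gxy.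
Qed.

Lemma face_nxt a : face (Some (nxt a)) = face (Some a).
Proof.
apply/esym/glue_face; apply/orP; left; apply/existsP; exists a.
by rewrite !eqxx.
Qed.

Section Invariant.

Variables (T : eqType) (H : option D -> T).
Let RH x y := H (omap tw y) == H x.
Let RC b c := H (Some (tw c)) == H (Some b).

Lemma path_head x x' s : H x = H x' -> path RH x s = path RH x' s.
Proof. by case: s => //= y s; rewrite /RH => ->. Qed.

Lemma path_lf q l x : path RH q (map Some l) -> H (Some x) = H (last q (map Some l)) ->
  path RC x (rev (map tw l)) /\ H (Some (last x (rev (map tw l)))) = H q.
Proof.
elim: l q => //= y l IHl q /andP[/eqP Hy pl] /(IHl _ pl)[pr Hr].
rewrite rev_cons rcons_path pr last_rcons; split; last exact: Hy.
by rewrite /RC twK Hr /=.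
Qed.

Lemma path_rg q x l : path RH q (map Some l) -> H (Some x) = H q -> path RC x l.
Proof.
case: l => //= y l /andP[/eqP Hy pl] Hx; rewrite /RC Hx Hy eqxx /=.
by move: pl; rewrite path_map.
Qed.

(** The gap below [v] has the same lower border [q] on both sides. The gap above [v] has the lower
    borders [lend v] and [rend v], whence the last hypothesis. *)
Lemma cycle_cyc v : path RH None (lslab v) -> path RH None (slab v) ->
  H (lend v) = H (rend v) -> cycle RC (cyc v).
Proof.
rewrite /slab /lslab !map_cat !rcons_cat !cat_path => /and3P[_ pl _] /and3P[_ pr _].
set q := last None _ in pl pr.
rewrite /lend /rend !map_cat !last_cat -/q => e.
have [x up_x] : exists x, up v = Some x.
  rewrite /up; move: (no_isolated v); rewrite /cyc.
  case: (rg v) => [|y s _]; last by rewrite map_cat last_cat /= last_map; eexists.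
  rewrite !cats0; case: (lf v) => // y s _.
  by rewrite map_cons rev_cons map_rcons last_rcons; eexists.
have Hx : H (Some x) = H (last q (map Some (lf v))).
  rewrite -up_x /up /cyc; case rgE : (rg v) => [|y s].
    rewrite e rgE cats0 /=; move: (no_isolated v); rewrite rgE cats0.
    move: pl; case: (lf v) => // y s /= /andP[/eqP Hy _] _.
    by rewrite rev_cons map_rcons last_rcons.
  by rewrite map_cat last_cat e rgE.
have [p1 e1] := path_lf pl Hx.
have p2 := path_rg pr e1.
rewrite (cycle_path x).
have -> : last x (cyc v) = x.
  move: up_x; rewrite /up; have: cyc v != [::].
    by move: (no_isolated v); rewrite /cyc -!size_eq0 !size_cat size_rev size_map.
  by case: (cyc v) => //= y s _; rewrite last_map => -[].
by rewrite cat_path p1.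
Qed.

End Invariant.

Lemma face_slab v : path (fun x y => face (omap tw y) == face x) None (slab v).
Proof.
apply: path_zipT => x y xy; apply/eqP/esym/glue_face.
by apply/orP; right; apply/existsP; exists v; rewrite otwK.
Qed.

(** Induction along the sweep: by [slabS], the slab to the right of a vertex is the slab to the left
    of the next one. *)
Lemma path_slabE (r : rel (option D)) : r None None ->
  (forall v, path r None (lslab v) -> path r None (slab v)) ->
  forall v, path r None (lslab v) /\ path r None (slab v).
Proof.
move=> r0 step v; suff pl : path r None (lslab v) by split=> //; apply: step.
move: {2}(val v) (erefl (val v)) => k; elim: k v => [|k IHk] v vk.
  by rewrite /lslab slab0 //= r0.
have lt_k : k < n by have := ltn_ord v; rewrite -[nat_of_ord v]/(val v) vk; apply: ltnW.
have := slabS (v := Ordinal lt_k) (w := v) vk; rewrite /lslab => <-.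
by apply: (step (Ordinal lt_k)); apply: IHk.
Qed.

Lemma face_lslab v : path (fun x y => face (omap tw y) == face x) None (lslab v).
Proof. by apply: (path_slabE _ _ v).1 => // w _; apply: face_slab. Qed.

(** The corner at [v] that contains the upward direction opens onto the gap above [v] on both
    sides. *)
Lemma face_ends v : face (lend v) = face (up v) /\ face (rend v) = face (up v).
Proof.
have pl := face_lslab v; have pr := face_slab v.
have cycP : forall d, d \in cyc v -> face (Some (tw d)) = face (Some (prev (cyc v) d)).
  by move=> d; rewrite mem_cyc => /eqP <-; rewrite -[in RHS](twK d) -/(hd _) face_nxt.
have firstP x s : cyc v = x :: s -> face (Some (tw x)) = face (up v).
  move=> cE; rewrite cycP ?cE ?mem_head // /up cE; congr (face _).
  rewrite /= last_map -prev_head //.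
  by have := uniq_cyc v; rewrite cE => /andP[].
move: pl pr; rewrite /slab /lslab !map_cat !rcons_cat !cat_path.
move=> /and3P[_ pl _] /and3P[_ pr _].
rewrite /lend /rend !map_cat !last_cat.
set q := last None _ in pl pr *; split.
  case/lastP lfE: (lf v) => [|s y]; last first.
    rewrite map_rcons last_rcons -[y]twK; apply: (firstP _ (rev (map tw s) ++ rg v)).
    by rewrite /cyc lfE map_rcons rev_rcons.
  case rgE: (rg v) => [|x s]; first by move: (no_isolated v); rewrite lfE rgE.
  rewrite -(firstP x s) ?/cyc ?lfE ?rgE //; apply/esym/eqP.
  by move: pr; rewrite rgE => /andP[].
case rgE: (rg v) => [|x s]; last by rewrite /up /cyc rgE map_cat last_cat.
rewrite /up /cyc rgE cats0; case lfE: (lf v) => [|y s].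
  by move: (no_isolated v); rewrite lfE rgE.
rewrite map_cons rev_cons map_rcons last_rcons; apply/esym/eqP.
by move: pl; rewrite lfE => /andP[].
Qed.

(* The region graph: its nodes are the rightward darts and the outside below, and each *)
(* vertex links the two nodes bounding from below the gap above it. A function constant *)
(* along links extends to the leftward darts by its value on what lies just below them. *)
Lemma face_card c :
  #|[set d | rt d && (face (Some d) == c)]| + (face None == c)
    <= #|[set v | face (up v) == c]|.+1.
Proof.
pose node (x : option D) := if x is Some d then rt d else true.
pose C := [set x | node x && (face x == c)].
have -> : #|[set d | rt d && (face (Some d) == c)]| + (face None == c) = #|C|.
  rewrite (cardsD1 None C) addnC inE /=; congr (_ + _).
  rewrite -(card_imset _ Some_inj); apply: eq_card => -[d|]; rewrite !inE /=.
    by rewrite mem_imset ?inE //; apply: Some_inj.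
  by apply/imsetP=> -[].
have [->|[x0 x0C]] := set_0Vmem C; first by rewrite cards0.
have node_last s : (forall d, d \in s -> rt d) -> node (last None (map Some s)).
  by case/lastP: s => //= s x H; rewrite map_rcons last_rcons /= H ?mem_rcons ?mem_head.
have node_lend v : node (lend v).
  apply: node_last => d; rewrite mem_cat => /orP[/(allP (rt_bl v))//|].
  by rewrite mem_lf => /andP[].
have node_rend v : node (rend v).
  apply: node_last => d; rewrite mem_cat => /orP[/(allP (rt_bl v))//|].
  by rewrite mem_rg => /andP[].
apply: leq_trans (connected_card (l := lend) (r := rend) x0C _) _; last first.
  rewrite ltnS; apply: subset_leq_card; apply/subsetP=> v; rewrite !inE node_lend node_rend /=.
  by rewrite (face_ends v).1 => /andP[].
move=> A AC x0A closA.
(* At a vertex whose upward direction lies in another region, neither end is in [C], so closure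
   holds at every vertex. *)
have {}closA v : (lend v \in A) = (rend v \in A).
  have [fv|fv] := boolP (face (up v) == c).
    by apply: closA; rewrite inE ?node_lend ?node_rend ?(face_ends v).1 ?(face_ends v).2.
  rewrite !(contraNF (subsetP AC _)) // inE ?node_lend ?node_rend.
    by rewrite (face_ends v).2.
  by rewrite (face_ends v).1.
pose below d := let s := bl (tl d) ++ rg (tl d) in nth None (None :: map Some s) (index d s).
pose H x := if x is Some d then if rt d then x \in A else below (tw d) \in A else x \in A.
have H_node x : node x -> H x = (x \in A) by case: x => //= d ->.
have [pl pr] : (forall v, path (fun x y => H (omap tw y) == H x) None (lslab v)) /\
               (forall v, path (fun x y => H (omap tw y) == H x) None (slab v)).
  suff H' v : path (fun x y => H (omap tw y) == H x) None (lslab v) /\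
              path (fun x y => H (omap tw y) == H x) None (slab v).
    by split=> v; case: (H' v).
  apply: path_slabE => //= {}v; rewrite /slab /lslab !map_cat !rcons_cat !cat_path.
  set q := last _ _; case/and3P=> -> pl pa /=; apply/andP; split; last first.
    rewrite -(path_head (x := last q (map Some (lf v)))) //.
    by have := closA v; rewrite -!H_node // /lend /rend !map_cat !last_cat.
  apply/(pathP None) => i; rewrite size_map => lti.
  have [d rgE] : exists d, nth None (map Some (rg v)) i = Some d.
    by case: (rg v) lti => // d s lti; exists (nth d (d :: s) i); rewrite (nth_map d).
  have id : nth d (rg v) i = d by apply: Some_inj; rewrite -rgE (nth_map d).
  have drg : d \in rg v by rewrite -id mem_nth.
  move: (drg); rewrite mem_rg => /andP[rd /eqP tld].
  rewrite rgE /= rt_tw rd /= twK.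
  have us : uniq (bl v ++ rg v).
    by have := uniq_slab v; rewrite catA cat_uniq => /andP[].
  have -> : below d = nth None (q :: map Some (rg v)) i.
    rewrite /below tld; have -> : index d (bl v ++ rg v) = size (bl v) + i.
      have := index_uniq d (i := size (bl v) + i) _ us.
      have ltF j : (size (bl v) + j < size (bl v)) = false by lia.
      rewrite nth_cat ltF addKn id => -> //.
      by rewrite size_cat ltn_add2l.
    rewrite map_cat; case: i {lti rgE id} => [|i].
      rewrite addn0 /= -cat_cons nth_cat /= size_map ltnS leqnn /q (last_nth None).
      by rewrite size_map.
    by rewrite addnS /= nth_cat size_map ltnNge leq_addr /= addKn.
  rewrite -H_node //; case: i {lti rgE id} => [|i] /=.
    exact: node_last (allP (rt_bl v)).
  case: (ltnP i (size (rg v))) => lti; last by rewrite nth_default ?size_map.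
  rewrite (nth_map d) //.
  by have := mem_nth d lti; rewrite mem_rg => /andP[].
have H_face x y : face x = face y -> H x = H y.
  move/eqP; rewrite (root_connect connect_face_sym) => /connectP[p].
  have H_glue a b : glue a b -> H a = H b.
    case/orP=> [/existsP[d /andP[/eqP-> /eqP->]]|/existsP[v]].
      have e : H (lend (hd d)) = H (rend (hd d)) by rewrite (H_node _ (node_lend _)) H_node.
      have cc := cycle_cyc (pl (hd d)) (pr (hd d)) e.
      have tc : tw d \in cyc (hd d) by rewrite mem_cyc.
      by have := prev_cycle cc tc => /eqP; rewrite twK.
    by move/(sub_path_zip (pr v)); rewrite otwK => /eqP.
  elim: p x => /= [x _ -> //|z p IHp x /andP[xz pz] /(IHp _ pz) <-].
  by case/orP: xz => /H_glue.
apply/eqP; rewrite eqEsubset AC; apply/subsetP=> x; rewrite inE => /andP[nx /eqP fx].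
have := subsetP AC _ x0A; rewrite inE => /andP[nx0 /eqP fx0].
by rewrite -H_node // (H_face x x0) ?fx ?fx0 // H_node.
Qed.

(** * Charging the corners by sextant boundaries *)

Hypothesis simple : forall d d', tl d = tl d' -> hd d = hd d' -> d = d'.
Hypothesis no_loop : forall d, tl d != hd d.

Variable sec : D -> nat.
Hypothesis sec_le5 : forall d, sec d <= 5.
Hypothesis sec_rt : forall d, rt d -> sec d = sec (tw d) + 3.
Hypothesis sec_sorted : forall v, sorted leq (map sec (cyc v)).

(* If [sec d] is the sextant of [d], counted from the upward direction, then [mu b] is *)
(* the number of sextant boundaries in the corner between [b] and the next dart. *)
Definition mu b := sec (next (cyc (tl b)) b) + 6 * (Some b == up (tl b)) - sec b.

(** The truncated subtraction in [mu] is exact: sextants do not decrease along [cyc], except from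
    its last dart to its first, where a full turn of 6 is added. *)
Lemma mu_sec b : mu b + sec b = sec (next (cyc (tl b)) b) + 6 * (Some b == up (tl b)).
Proof.
apply: subnK; case: eqP => bup.
  by rewrite muln1 (leq_trans (sec_le5 b)) // ltnW // leq_addl.
rewrite addn0 next_nth; have := mem_cyc (tl b) b; rewrite eqxx => bc; rewrite bc.
have := sec_sorted (tl b); move: bup bc; rewrite /up; case: (cyc (tl b)) => // x s bup bc.
move/(sortedP (sec x)) => so.
have : index b (x :: s) < size (x :: s) by rewrite index_mem.
rewrite ltnS leq_eqVlt => /orP[/eqP bs|lt_b].
  by case: bup; rewrite map_cons /= last_map (last_nth x) -[X in nth _ _ X]bs nth_index.
have := so (index b (x :: s)); rewrite size_map ltnS => /(_ lt_b).
by rewrite (nth_map x) ?index_mem // nth_index // (nth_map x).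
Qed.

Lemma up_tl v b : up v = Some b -> tl b = v.
Proof.
rewrite /up => e; apply/eqP; rewrite -mem_cyc; move: e.
by case: (cyc v) => //= x s; rewrite last_map => -[<-]; apply: mem_last.
Qed.

Lemma upP v : exists b, up v = Some b.
Proof.
rewrite /up; case cE: (cyc v) => [|x s]; last by rewrite /= last_map; eexists.
move: (no_isolated v) (congr1 size cE).
by rewrite -size_eq0 !size_cat size_rev size_map => /eqP.
Qed.

Lemma mu_vertex v : \sum_(b | tl b == v) mu b = 6.
Proof.
have e : \sum_(b | tl b == v) (mu b + sec b) =
    \sum_(b | tl b == v) sec (next (cyc v) b) + 6.
  rewrite (eq_bigr (fun b => sec (next (cyc v) b) + 6 * (Some b == up v))); last first.
    by move=> b /eqP <-; apply: mu_sec.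
  rewrite big_split /=; congr (_ + _); have [b0 b0up] := upP v.
  rewrite (bigD1 b0) /= ?(up_tl b0up) // b0up eqxx big1 ?addn0 // => b /andP[_ bb0].
  by rewrite (inj_eq Some_inj) (negPf bb0).
have prev_inj := can_inj (next_prev (uniq_cyc v)).
move: e; rewrite big_split /= [in X in _ = X + _](reindex_inj prev_inj) /=.
rewrite [X in _ = X + _](eq_big (fun b => tl b == v) sec) //=; first lia.
  by move=> b; rewrite -!mem_cyc mem_prev.
by move=> b _; rewrite next_prev ?uniq_cyc.
Qed.

Lemma mu_nxt a : mu (nxt a) + sec (nxt a) = sec (tw a) %[mod 6].
Proof. by rewrite mu_sec next_nxt addnC mulnC modnMDl. Qed.

(** At a dead end the corner is the whole turn. *)
Lemma mu_back a : nxt a = tw a -> mu (nxt a) = 6.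
Proof.
move=> e; have := next_nxt a; rewrite e => /next_fixed cE.
have {}cE : cyc (tl (tw a)) = [:: tw a] by rewrite cE ?uniq_cyc ?mem_cyc.
by rewrite /mu /up cE /= !eqxx muln1 addKn.
Qed.

Definition fcard c := #|[set d | face (Some d) == c]|.
Definition rcard c := #|[set d | rt d && (face (Some d) == c)]|.
Definition ucard c := #|[set v | face (up v) == c]|.

(** Summing [mu_sec] over the region, [nxt] turns the sextants of successors into those of reversed
    darts. Reversal changes a sextant by -3 for a rightward dart and by 3 for a leftward one, and
    each upward direction adds 6. *)
Lemma mu_face c : \sum_(b | face (Some b) == c) mu b + 6 * rcard c = 3 * fcard c + 6 * ucard c.
Proof.
pose P := fun b => face (Some b) == c.
have e1 : \sum_(b | P b) (mu b + sec b) = \sum_(b | P b) sec (tw b) + 6 * ucard c.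
  rewrite (eq_bigr _ (fun b _ => mu_sec b)) big_split /= -big_distrr /=; congr (_ + 6 * _).
    rewrite (reindex_inj nxt_inj); apply: eq_big => b; first by rewrite /P face_nxt.
    by rewrite next_nxt.
  rewrite -big_mkcondr sum1dep_card /ucard; set A := [set b | _].
  have tlA : {in A &, injective tl}.
    move=> b b'; rewrite !inE => /andP[_ /eqP e] /andP[_ /eqP e'] ebb'.
    by apply: Some_inj; rewrite e e' ebb'.
  rewrite -(card_in_imset tlA); apply: eq_card => v; rewrite inE.
  apply/imsetP/idP => [[b]|fv]; first by rewrite !inE => /andP[Pb /eqP e] ->; rewrite -e.
  have [b bup] := upP v; exists b; last by rewrite (up_tl bup).
  by rewrite !inE (up_tl bup) bup eqxx andbT /P -bup.
have e2 : \sum_(b | P b) sec (tw b) + 6 * rcard c = \sum_(b | P b) sec b + 3 * fcard c.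
  rewrite /rcard /fcard -!sum1dep_card !big_distrr /= big_mkcondl -!big_split /=.
  apply: eq_bigr => b _; case: ifP => rb; first by rewrite (sec_rt rb); lia.
  by have := @sec_rt (tw b); rewrite rt_tw rb twK => /(_ isT) ->; lia.
move: e1 e2; rewrite /P big_split /=; lia.
Qed.

Lemma order_le_fcard d : order nxt d <= fcard (face (Some d)).
Proof.
apply: subset_leq_card; apply/subsetP=> x; rewrite inE => /iter_findex <-.
by elim: (findex nxt d x) => //= k; rewrite face_nxt.
Qed.

Lemma order_gt1 d : 1 < order nxt d.
Proof.
rewrite ltn_neqAle order_gt0 andbT eq_sym; apply/eqP=> o1.
have := iter_order nxt_inj d; rewrite o1 /= => /(congr1 tl); rewrite tl_nxt => /esym e.
by have := no_loop d; rewrite e eqxx.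
Qed.

Lemma nxt2 d : nxt (nxt d) = d -> nxt d = tw d.
Proof.
move=> e; apply: simple; first by rewrite tl_nxt.
by rewrite -tl_nxt e /hd twK.
Qed.

Lemma order2_mu d : order nxt d = 2 -> mu d = 6 /\ mu (nxt d) = 6.
Proof.
move=> o2; have e := iter_order nxt_inj d; rewrite o2 /= in e.
have e' : nxt (nxt (nxt d)) = nxt d by rewrite e.
have m2 := mu_back (nxt2 e'); rewrite e in m2.
by rewrite (mu_back (nxt2 e)).
Qed.

Lemma sec_tw d : sec (tw d) = sec d + 3 %[mod 6].
Proof.
case rd: (rt d); first by rewrite (sec_rt rd) -addnA modnDr.
by rewrite (sec_rt (d := tw d)) ?rt_tw ?rd // twK.
Qed.

Definition wt b : rat := ((mu b)%:R - 1 - (1 < mu b)%:R)%R.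

Lemma wt_geN1 b : (-1 <= wt b)%R.
Proof.
have : ((1 < mu b)%:R <= (mu b)%:R :> rat)%R.
  by rewrite Num.Theory.ler_nat; case: (mu b) => [|[]].
by rewrite /wt; lra.
Qed.

Lemma wt_ge0 b : 0 < mu b -> (0 <= wt b)%R.
Proof.
move=> m0; have : ((1 + (1 < mu b))%:R <= (mu b)%:R :> rat)%R.
  by rewrite Num.Theory.ler_nat; case: (mu b) m0 => [|[]].
by rewrite /wt GRing.natrD; lra.
Qed.

(** A total of 3 splits as 0 + 3 or 1 + 2, with charges -1 + 1 or 0 + 0; larger totals only help. *)
Lemma wt_pair b b' : mu b + mu b' = 3 %[mod 6] -> (0 <= wt b + wt b')%R.
Proof.
move=> m3; have : ((1 + (1 < mu b) + (1 + (1 < mu b')))%:R <= (mu b + mu b')%:R :> rat)%R.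
  by rewrite Num.Theory.ler_nat; case: (ltnP 1 (mu b)); case: (ltnP 1 (mu b')); lia.
by rewrite /wt !GRing.natrD; lra.
Qed.

Lemma wt_mu6 b : mu b = 6 -> (wt b = 4)%R.
Proof. by rewrite /wt => ->. Qed.

Hypothesis order3_sec : forall d, order nxt d = 3 ->
  sec (nxt d) = sec d + 2 %[mod 6] \/ sec (nxt d) = sec d + 4 %[mod 6].
Hypothesis order4_sec : forall d, order nxt d = 4 ->
  [\/ nxt d = tw d, nxt (nxt d) = tw (nxt d) | sec (nxt (nxt d)) = sec d + 3 %[mod 6]].

(** Two darts form an isolated edge, with charge 4 at both ends. In a unit triangle every [mu] is 1
    or 5 modulo 6, hence positive. Four darts either contain a dead end, whose charge 4 outweighs
    the other three, or form a rhombus, where consecutive corners pair up to 3 modulo 6. *)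
Lemma orbit_wt_ge0 d : order nxt d <= 4 ->
  (0 <= \sum_(j < order nxt d) wt (iter j nxt d))%R.
Proof.
move=> o4; have o1 := order_gt1 d.
have [o|[o|o]] : order nxt d = 2 \/ order nxt d = 3 \/ order nxt d = 4 by lia.
all: rewrite o !big_ord_recr big_ord0 /= GRing.add0r.
- by have [m1 m2] := order2_mu o; rewrite !wt_mu6.
- have e := iter_order nxt_inj d; rewrite o /= in e.
  have wt3 x : order nxt x = 3 -> (0 <= wt (nxt x))%R.
    move=> o3; apply: wt_ge0; have := mu_nxt x; have := sec_tw x; have := order3_sec o3.
    lia.
  have o_nxt x : order nxt x = 3 -> order nxt (nxt x) = 3.
    by move=> <-; apply: eq_card => y; rewrite !inE; apply/esym/(same_fconnect1 nxt_inj).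
  have w1 := wt3 _ (o_nxt _ (o_nxt _ o)); rewrite e in w1.
  by have := wt3 _ o; have := wt3 _ (o_nxt _ o); lra.
- have e := iter_order nxt_inj d; rewrite o /= in e.
  have := wt_geN1 d; have := wt_geN1 (nxt d); have := wt_geN1 (nxt (nxt d)).
  have := wt_geN1 (nxt (nxt (nxt d))).
  case: (order4_sec o) => [/mu_back/wt_mu6->|/mu_back/wt_mu6->|s2]; [lra | lra |].
  move=> _ _ _ _.
  have w1 : (0 <= wt (nxt d) + wt (nxt (nxt d)))%R.
    apply: wt_pair; have := mu_nxt d; have := mu_nxt (nxt d); have := sec_tw d.
    have := sec_tw (nxt d); lia.
  have w2 : (0 <= wt (nxt (nxt (nxt d))) + wt d)%R.
    apply: wt_pair; have := mu_nxt (nxt (nxt d)); have := mu_nxt (nxt (nxt (nxt d))).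
    by rewrite e; have := sec_tw (nxt (nxt d)); have := sec_tw (nxt (nxt (nxt d))); lia.
  by lra.
Qed.

Lemma wt_sum (P : pred D) : (\sum_(b | P b) wt b =
  (\sum_(b | P b) mu b)%:R - (\sum_(b | P b) 1)%:R - (\sum_(b | P b) (1 < mu b))%:R)%R.
Proof. by rewrite !GRing.natr_sum -!GRing.sumrB. Qed.

Lemma fcardE c : fcard c = \sum_(b | face (Some b) == c) 1.
Proof. by rewrite /fcard -sum1dep_card. Qed.

Lemma large_le c : \sum_(b | face (Some b) == c) (1 < mu b) <= fcard c.
Proof. by rewrite fcardE; apply: leq_sum => b _; apply: leq_b1. Qed.

Lemma mu_large c : 2 * \sum_(b | face (Some b) == c) (1 < mu b) <=
  \sum_(b | face (Some b) == c) mu b.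
Proof. by rewrite big_distrr; apply: leq_sum => b _; case: (mu b) => [|[]]. Qed.

Lemma face_wt_ge0 c : c != face None -> (0 <= \sum_(b | face (Some b) == c) wt b)%R.
Proof.
move=> c_in; have [k4|k5] := leqP (fcard c) 4.
  rewrite (orbit_average _ nxt_inj) => [|d]; last by rewrite face_nxt.
  apply: Num.Theory.sumr_ge0 => d /eqP dc.
  apply: Num.Theory.divr_ge0; rewrite ?Num.Theory.ler0n //.
  by apply: orbit_wt_ge0; rewrite (leq_trans (order_le_fcard d)) // dc.
(* Let k >= 5 be the number of darts. From m >= 3k - 6, m >= 2l and l <= k follows m >= k + l; the
   bound m >= 2l serves for k = l = 5. *)
have := mu_face c; have := face_card c; rewrite eq_sym (negPf c_in) -/(rcard c) -/(ucard c).
have := large_le c; have := mu_large c; rewrite wt_sum -fcardE => h1 h2 h3 h4.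
set m := \sum_(b | _) mu b in h1 h4 *; set l := \sum_(b | _) (_ < _) in h1 h2 *.
have : ((fcard c + l)%:R <= m%:R :> rat)%R by rewrite Num.Theory.ler_nat; lia.
by rewrite GRing.natrD; lra.
Qed.

Lemma outer_wt_ge : ((fcard (face None))%:R <= \sum_(b | face (Some b) == face None) wt b)%R.
Proof.
have := mu_face (face None); have := face_card (face None).
rewrite eqxx -/(rcard _) -/(ucard _) => h3 h4.
have h2 := large_le (face None); rewrite wt_sum -fcardE.
set m := \sum_(b | _) mu b in h4 *; set l := \sum_(b | _) (_ < _) in h2 *.
have : ((fcard (face None) + fcard (face None) + l)%:R <= m%:R :> rat)%R.
  by rewrite Num.Theory.ler_nat; lia.
by rewrite !GRing.natrD; lra.
Qed.

Definition deg v := #|[set d | tl d == v]|.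

Lemma vertex_wt v : (\sum_(b | tl b == v) wt b <= (5 - deg v)%:R)%R.
Proof.
rewrite wt_sum mu_vertex; have -> : \sum_(b | tl b == v) 1 = deg v by rewrite sum1dep_card.
set l := \sum_(b | _) _.
have l1 : deg v <= 5 -> 1 <= l.
  move=> d5; rewrite lt0n; apply/eqP=> l0; have := mu_vertex v.
  have : \sum_(b | tl b == v) mu b <= \sum_(b | tl b == v) 1.
    apply: leq_sum => b bv; move/eqP: l0; rewrite sum_nat_eq0 => /forallP /(_ b).
    by rewrite bv /=; case: (mu b) => [|[]].
  by rewrite sum1dep_card -/(deg v); lia.
have : (6%:R <= (5 - deg v + deg v + l)%:R :> rat)%R by rewrite Num.Theory.ler_nat; lia.
by rewrite !GRing.natrD; lra.
Qed.

Lemma outer_le_deficit : fcard (face None) <= \sum_v (5 - deg v).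
Proof.
rewrite -(Num.Theory.ler_nat rat) GRing.natr_sum.
apply: (Order.POrderTheory.le_trans outer_wt_ge).
have le_v : (\sum_v \sum_(b | tl b == v) wt b <= \sum_v (5 - deg v)%:R)%R.
  by apply: Num.Theory.ler_sum => v _; apply: vertex_wt.
apply: Order.POrderTheory.le_trans le_v.
have -> : (\sum_v \sum_(b | tl b == v) wt b = \sum_b wt b)%R.
  by rewrite [RHS](partition_big tl xpredT).
rewrite [X in (_ <= X)%R](partition_big (fun b => face (Some b)) xpredT) //=.
rewrite [X in (_ <= X)%R](bigD1 (face None)) //= Num.Theory.lerDl.
by apply: Num.Theory.sumr_ge0 => c; apply: face_wt_ge0.
Qed.

(** * Counting the triangular regions *)

(** The last condition is the equality case of [face_card]. By [mu_face] it leaves only 3 sextant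
    boundaries in the region, which excludes orbits of 2 darts. *)
Definition triangle c :=
  [&& c != face None, fcard c == 3 & rcard c == (ucard c).+1].

Lemma triangle_order d : triangle (face (Some d)) -> order nxt d = 3.
Proof.
case/and3P=> _ /eqP f3 /eqP ru; have := order_gt1 d; have := order_le_fcard d.
rewrite f3 => o3 o1; have [o2|//] : order nxt d = 2 \/ order nxt d = 3 by lia.
have := mu_face (face (Some d)); rewrite f3 ru (bigD1 d) //=; have [-> _] := order2_mu o2; lia.
Qed.

Lemma sum_fcard : \sum_c fcard c = #|D|.
Proof.
rewrite -sum1_card (partition_big (fun b => face (Some b)) xpredT) //=.
by apply: eq_bigr => c _; rewrite fcardE.
Qed.

Lemma sum_rcard : 2 * \sum_c rcard c = #|D|.
Proof.
have -> : \sum_c rcard c = #|[set d | rt d]|.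
  rewrite -sum1dep_card (partition_big (fun b => face (Some b)) xpredT) //=.
  by apply: eq_bigr => c _; rewrite sum1dep_card.
rewrite -(cardsC [set d | rt d]) mul2n -addnn; congr addn.
rewrite -(card_imset _ (inv_inj twK)); apply: eq_card => d.
rewrite [RHS]inE inE; apply/imsetP/idP => [[d' + ->]|rd]; first by rewrite inE rt_tw => ->.
by exists (tw d); rewrite ?twK // inE rt_tw.
Qed.

Lemma sum_ucard : \sum_c ucard c = n.
Proof.
rewrite -[RHS]card_ord -sum1_card (partition_big (fun v => face (up v)) xpredT) //=.
by apply: eq_bigr => c _; rewrite sum1dep_card.
Qed.

Lemma sum_deg : \sum_v deg v = #|D|.
Proof.
rewrite -sum1_card (partition_big tl xpredT) //=.
by apply: eq_bigr => c _; rewrite sum1dep_card.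
Qed.

(** For a bounded region r <= u + 1, so 4r <= 4u + k as soon as k >= 4 or r <= u. The case k = 3, r
    = u + 1 is a triangle, which supplies the missing 1, and k = 2 makes r < u by [mu_face]. Summing
    over the regions, r totals half the number of darts and u totals n. *)
Lemma many_triangles :
  n + fcard (face None) <= #|[set c | triangle c]| + \sum_v (5 - deg v).
Proof.
have e c : rcard c * 4 + (if c == face None then fcard (face None) else 0) <=
    ucard c * 4 + fcard c + triangle c.
  rewrite /triangle; have h := face_card c.
  rewrite -/(rcard c) -/(ucard c) eq_sym in h.
  case: eqP h => [->|_] /= h; first by lia.
  have [d dc|c0] := pickP (fun d => face (Some d) == c); last first.
    have : rcard c <= fcard c.
      by apply: subset_leq_card; apply/subsetP=> d; rewrite !inE c0 andbF.
    have -> : fcard c = 0 by apply: eq_card0 => d; rewrite inE c0.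
    by lia.
  have o1 := order_gt1 d; have := order_le_fcard d; rewrite (eqP dc) => of3.
  have [f2|f2] := eqVneq (fcard c) 2; last first.
    by case: (fcard c =P 3); case: (rcard c =P (ucard c).+1); lia.
  have o2 : order nxt d = 2 by lia.
  have := mu_face c; rewrite f2 (bigD1 d) // (bigD1 (nxt d)) /=; last first.
    rewrite face_nxt dc /=; apply/eqP=> e; have := no_loop d.
    by rewrite -tl_nxt e eqxx.
  have [-> ->] := order2_mu o2; lia.
have : \sum_c (rcard c * 4 + (if c == face None then fcard (face None) else 0)) <=
    \sum_c (ucard c * 4 + fcard c + triangle c) by apply: leq_sum => c _.
have mulD (F : option D -> nat) : \sum_c F c * 4 = (\sum_c F c) * 4 by rewrite big_distrl.
rewrite !big_split /= !mulD -big_mkcond big_pred1_eq sum_ucard sum_fcard.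
have -> : \sum_c triangle c = #|[set c | triangle c]|.
  by rewrite -big_mkcond sum1dep_card.
have : \sum_(v < n) 5 <= \sum_v (5 - deg v) + \sum_v deg v.
  by rewrite -big_split; apply: leq_sum => v _ /=; lia.
rewrite sum_nat_const card_ord sum_deg; have := sum_rcard.
move: (fcard _) (#|[set c | triangle c]|) (\sum_(v < n) _) (\sum_c _) #|D| => l t s r m.
by lia.
Qed.

End Faces.

End Sweep.

Import Order.TTheory GRing.Theory Num.Theory.
Local Open Scope ring_scope.

(** * The isoperimetric inequality for equilateral closed walks *)

Section Isoperimetric.

Import normed_module.numFieldNormedType.Exports.

Variable R : realType.
Implicit Types (x y : nat -> R) (t : R).

Lemma mul_cos_lt_sin t : 0 < t <= pi / 2 -> t * cos t < sin t.
Proof.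
move=> /andP[t0 tpi]; have pi0 := pi_gt0 R.
have [|c] := @derive.MVT _ (@sin R) (@cos R) 0 t t0 (fun c _ => is_derive_sin c).
  by apply: subspace_topology.continuous_subspaceT => c; apply: continuous_sin.
rewrite in_itv /= => /andP[c0 ct]; rewrite sin0 !subr0 => ->.
rewrite mulrC ltr_pM2r // ltr_cos // in_itv /=; lra.
Qed.

(** Discrete Wirtinger inequality with fixed ends: 2 cos (pi / M) is the largest adjacency
    eigenvalue of the path on the M - 1 interior indices, with eigenvector sin (j pi / M). *)
Lemma wirtinger (M : nat) y : (1 < M)%N -> y 0%N = 0 -> y M = 0 ->
  0 <= \sum_(j < M) (cos (pi / M%:R) * (y j ^+ 2 + y j.+1 ^+ 2) - y j * y j.+1 *+ 2).
Proof.
move=> M1 y0 yM; set psi := pi / M%:R.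
have M0 : 0 < M%:R :> R by rewrite ltr0n; lia.
have psi_gt0 : 0 < psi by rewrite divr_gt0 // pi_gt0.
pose s (j : nat) := sin (psi *+ j); pose c (j : nat) := cos (psi *+ j).
have s_gt0 j : (0 < j < M)%N -> 0 < s j.
  move=> /andP[j0 jM]; apply: sin_gt0_pi; rewrite -mulr_natr mulr_gt0 ?ltr0n //=.
  by rewrite /psi mulrAC ltr_pdivrMr // ltr_pM2l ?pi_gt0 // ltr_nat.
have sS j : s j.+1 = s j * cos psi + c j * sin psi by rewrite /s mulrSr sinD.
have cS j : c j.+1 = c j * cos psi - s j * sin psi by rewrite /c mulrSr cosD.
have sB j : s j = s j.+1 * cos psi - c j.+1 * sin psi.
  by rewrite sS cS; have := cos2Dsin2 psi => e; rewrite -[LHS]mulr1 -e; ring.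
have sM : s M = 0 by rewrite /s -mulr_natr /psi divfK ?gt_eqF // sinpi.
(* The telescoping weights sin psi * cot (j psi) make every summand a square. *)
pose u j := sin psi * c j / s j * y j ^+ 2.
have step (j : 'I_M) : u j.+1 - u j <=
    cos psi * (y j ^+ 2 + y j.+1 ^+ 2) - y j * y j.+1 *+ 2.
  set C := cos psi in sS sB *; set S := sin psi in sS sB u *.
  have jM := ltn_ord j; rewrite -subr_ge0.
  have up : (0 < j)%N -> C + S * c j / s j = s j.+1 / s j.
    by move=> j0; rewrite sS; field; rewrite gt_eqF // s_gt0 // j0.
  have dn : (j.+1 < M)%N -> C - S * c j.+1 / s j.+1 = s j / s j.+1.
    by move=> j1; rewrite [in RHS]sB; field; rewrite gt_eqF // s_gt0.
  rewrite /u; case: (posnP j) => [j0|j0].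
    rewrite j0 y0 in dn *; have := dn _; rewrite /s mulr0n sin0 mul0r => e.
    have {}e := e M1; rewrite expr0n /= mulr0 !mul0r add0r.
    by rewrite mul0rn !subr0 -mulrBl e mul0r.
  case: (ltnP j.+1 M) => j1; last first.
    have jE : j.+1 = M by lia.
    have := up j0; rewrite jE yM sM mul0r => e.
    rewrite expr0n /= !mulr0 mul0rn subr0 addr0 sub0r opprK -mulrDl.
    by rewrite [_ + _]e mul0r.
  have s0 : 0 < s j by rewrite s_gt0 // j0.
  have s1 : 0 < s j.+1 by rewrite s_gt0.
  have -> : C * (y j ^+ 2 + y j.+1 ^+ 2) - y j * y j.+1 *+ 2 -
     (S * c j.+1 / s j.+1 * y j.+1 ^+ 2 - S * c j / s j * y j ^+ 2) =
     (C + S * c j / s j) * y j ^+ 2 + (C - S * c j.+1 / s j.+1) * y j.+1 ^+ 2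
       - y j * y j.+1 *+ 2 by ring.
  rewrite up // dn //.
  have -> : s j.+1 / s j * y j ^+ 2 + s j / s j.+1 * y j.+1 ^+ 2 - y j * y j.+1 *+ 2 =
     (y j * s j.+1 - y j.+1 * s j) ^+ 2 / (s j * s j.+1) by field; rewrite !gt_eqF.
  by rewrite divr_ge0 ?sqr_ge0 // ltW // mulr_gt0.
apply: le_trans (ler_sum _ (fun j _ => step j)).
by rewrite -(big_mkord xpredT (fun j => u j.+1 - u j)) telescope_sumr // /u yM y0; lra.
Qed.

(** The bound is the area of the half disk whose arc has the length of the walk. The angle [f] is
    half of pi / M, so that AM-GM produces the quadratic form of [wirtinger]; strictness comes from
    f < tan f. *)
Lemma half_arc (M : nat) x y (d2 : R) : (1 < M)%N -> 0 < d2 -> y 0%N = 0 -> y M = 0 ->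
  (forall j, (x j.+1 - x j) ^+ 2 + (y j.+1 - y j) ^+ 2 = d2) ->
  \sum_(j < M) (x j.+1 - x j) * (y j + y j.+1) / 2 < M%:R ^+ 2 * d2 / (2 * pi).
Proof.
move=> M1 d0 y0 yM steps; have pi0 := pi_gt0 R.
have M2 : 2 <= M%:R :> R by rewrite (ler_nat R 2).
pose f : R := pi / (2 * M%:R).
have f0 : 0 < f by rewrite divr_gt0 // mulr_gt0 //; lra.
have fpi : f < pi / 2 by rewrite /f invfM mulrA ltr_pdivrMr ?ltr_pMr; nra.
have c0 : 0 < cos f by apply: cos_gt0_pihalf; lra.
have s0 : f * cos f < sin f by apply: mul_cos_lt_sin; rewrite f0 ltW.
have sf0 : 0 < sin f by apply: lt_trans s0; rewrite mulr_gt0.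
set c := cos f in c0 s0 *; set s := sin f in sf0 s0 *.
set T := \sum_(j < M) _; set Q := \sum_(j < M)
   (cos (pi / M%:R) * (y j ^+ 2 + y j.+1 ^+ 2) - y j * y j.+1 *+ 2).
have Q0 : 0 <= Q by apply: wirtinger.
have psiE : pi / M%:R = f + f by rewrite /f; field; rewrite gt_eqF //; lra.
have sc : c ^+ 2 + s ^+ 2 = 1 := cos2Dsin2 f.
(* AM-GM on the abscissa step and the mean ordinate. *)
have le_T : 4 * s * c * T <= M%:R * c ^+ 2 * d2 - Q.
  have -> : M%:R * c ^+ 2 * d2 = \sum_(j < M) c ^+ 2 * d2.
    by rewrite sumr_const card_ord -[RHS]mulr_natl mulrA.
  rewrite -sumrB mulr_sumr; apply: ler_sum => j _; rewrite psiE cosD -/c -/s -(steps j).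
  have := sqr_ge0 (c * (x j.+1 - x j) - s * (y j + y j.+1)).
  rewrite -subr_ge0 => h; apply: le_trans h _; rewrite le_eqVlt; apply/orP; left; apply/eqP.
  have -> : y j * y j.+1 = (c ^+ 2 + s ^+ 2) * (y j * y j.+1) by rewrite sc mul1r.
  by field.
have le_T2 : 4 * s * T <= M%:R * c * d2 by rewrite -(ler_pM2l c0); lra.
have fE : f * (2 * M%:R) = pi by rewrite /f divfK // gt_eqF //; lra.
have lt1 : pi * c < 2 * M%:R * s by rewrite -fE; nra.
rewrite ltr_pdivlMr ?mulr_gt0 // -(ltr_pM2r sf0).
have md0 : 0 < M%:R * d2 by rewrite mulr_gt0 //; lra.
by have := ler_wpM2l (ltW pi0) le_T2; have := ltr_pM2r md0 (pi * c) (2 * M%:R * s); lra.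
Qed.

Lemma trap_subdivide (N : nat) x y :
  let h (z : nat -> R) i := (z i./2 + z (uphalf i)) / 2 in
  \sum_(i < N + N) (h x i.+1 - h x i) * (h y i + h y i.+1) / 2 =
  \sum_(j < N) (x j.+1 - x j) * (y j + y j.+1) / 2.
Proof.
move=> h; elim: N => [|N IHN]; first by rewrite !big_ord0.
rewrite addSn addnS !big_ord_recr /= IHN -addrA; congr (_ + _).
have e : (N + N)%N = N.*2 by rewrite addnn.
rewrite /h /= e !uphalf_double !doubleK.
by field.
Qed.

Lemma isoperimetric (N : nat) x y : (1 < N)%N -> x N = x 0%N -> y N = y 0%N ->
  (forall j, (x j.+1 - x j) ^+ 2 + (y j.+1 - y j) ^+ 2 = 1) ->
  \sum_(j < N) (x j.+1 - x j) * (y j + y j.+1) / 2 < N%:R ^+ 2 / (4 * pi).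
Proof.
move=> N1 xN yN steps.
(* Halving the steps makes the number of steps even; the perimeter is then cut in *)
(* two arcs of equal length, whose common chord is taken as axis of abscissas. *)
pose h (z : nat -> R) i := (z i./2 + z (uphalf i)) / 2.
have hN : (N + N)./2%N = N by rewrite addnn doubleK.
have huN : uphalf (N + N)%N = N by rewrite addnn uphalf_double.
have hp z : z N = z 0%N -> h z (N + N)%N = h z 0%N by rewrite /h hN huN /= => ->.
have hsteps i : (h x i.+1 - h x i) ^+ 2 + (h y i.+1 - h y i) ^+ 2 = 1 / 4.
  have hB z : h z i.+1 - h z i = (z (i./2).+1 - z i./2) / 2 by rewrite /h /=; field.
  by rewrite !hB !expr_div_n -mulrDl steps; field.
rewrite -trap_subdivide -/h.
have [a [b [ab chord]]] : exists a b : R, a ^+ 2 + b ^+ 2 = 1 /\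
    a * (h y N - h y 0%N) = b * (h x N - h x 0%N).
  set p := h x N - _; set q := h y N - _.
  have [pq0|pq0] := eqVneq (p ^+ 2 + q ^+ 2) 0.
    exists 1, 0; rewrite expr1n expr0n /= addr0 mul1r mul0r; split=> //.
    by apply/eqP; rewrite -sqrf_eq0 eq_le sqr_ge0 andbT; have := sqr_ge0 p; lra.
  set r := Num.sqrt (p ^+ 2 + q ^+ 2).
  have rE : r ^+ 2 = p ^+ 2 + q ^+ 2 by rewrite sqr_sqrtr // addr_ge0 // sqr_ge0.
  have r0 : r != 0 by rewrite -sqrf_eq0 rE.
  exists (p / r), (q / r); split; last by ring.
  by rewrite !expr_div_n -mulrDl -rE divff // sqrf_eq0.
pose u i := a * h x i + b * h y i.
pose v i := (a * h y i - b * h x i) - (a * h y 0%N - b * h x 0%N).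
have v0 : v 0%N = 0 by rewrite /v subrr.
have vN : v N = 0 by rewrite /v; lra.
have vNN : v (N + N)%N = 0 by rewrite /v !hp // subrr.
have uv_steps i : (u i.+1 - u i) ^+ 2 + (v i.+1 - v i) ^+ 2 = 1 / 4.
  transitivity ((a ^+ 2 + b ^+ 2) *
      ((h x i.+1 - h x i) ^+ 2 + (h y i.+1 - h y i) ^+ 2)); first by rewrite /u /v; ring.
  by rewrite ab mul1r hsteps.
have q0 : 0 < 1 / 4 :> R by lra.
have arc1 := half_arc N1 q0 v0 vN uv_steps.
have arc2 : \sum_(i < N) (u (N + i).+1%N - u (N + i)%N) * (v (N + i)%N + v (N + i).+1%N) / 2
    < N%:R ^+ 2 * (1 / 4) / (2 * pi).
  have := @half_arc N (fun i => u (N + i)%N) (fun i => v (N + i)%N) _ N1 q0.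
  rewrite addn0 => /(_ vN vNN) arc2; under eq_bigr => i _ do rewrite -addnS.
  by apply: arc2 => j; rewrite addnS uv_steps.
(* The trapezoid sums in the two frames differ, step by step, by the increments of [w], which cancel
   along a closed walk. *)
pose w i := (h y 0%N * a - b * h x 0%N) * u i + a * b * (h x i ^+ 2 - h y i ^+ 2) / 2
  + b ^+ 2 * h x i * h y i.
have -> : \sum_(i < N + N) (h x i.+1 - h x i) * (h y i + h y i.+1) / 2 =
    \sum_(i < N + N) (u i.+1 - u i) * (v i + v i.+1) / 2.
  have -> : \sum_(i < N + N) (h x i.+1 - h x i) * (h y i + h y i.+1) / 2 =
     \sum_(i < N + N) ((u i.+1 - u i) * (v i + v i.+1) / 2 + (w i.+1 - w i)).
    apply: eq_bigr => i _; 
    transitivity ((a ^+ 2 + b ^+ 2) * ((h x i.+1 - h x i) * (h y i + h y i.+1) / 2)).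
      by rewrite ab mul1r.
    by rewrite /w /u /v; field.
  rewrite big_split /= -(big_mkord xpredT (fun i => w i.+1 - w i)) telescope_sumr //.
  by rewrite /w /u !hp // subrr addr0.
rewrite big_split_ord /=.
have -> : N%:R ^+ 2 / (4 * pi) =
    N%:R ^+ 2 * (1 / 4) / (2 * pi) + N%:R ^+ 2 * (1 / 4) / (2 * pi) :> R.
  by move: (pi_gt0 R); move: pi => p p0; field; rewrite gt_eqF.
exact: ltrD.
Qed.

End Isoperimetric.

Lemma sort_pairwise (R : realType) (D : eqType) (f : D -> R) (r : rel D) s :
  uniq s -> {in s &, forall d d', d != d' -> f d <= f d' -> r d d'} ->
  pairwise r (sort (fun d d' => f d <= f d') s).
Proof.
move=> us fr; set t := sort _ s.
have ts : t =i s by move=> d; rewrite mem_sort.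
have : pairwise [rel d d' | (f d <= f d') && (d != d')] t.
  rewrite (pairwise_relI (fun d d' => f d <= f d') (fun d d' => d != d')).
  rewrite -uniq_pairwise sort_uniq us andbT.
  rewrite -sorted_pairwise; first by apply: sort_sorted => d d'; apply: le_total.
  by move=> d2 d1 d3; apply: le_trans.
apply: (@sub_in_pairwise _ (mem s)); last by apply/allP=> d; rewrite ts.
by move=> d d' ds d's /= /andP[le_f ne]; apply: fr.
Qed.

(** * Sextants *)

Section Sextants.

Variable R : realType.
Implicit Types x y : R.

(* The sextants are numbered counterclockwise from the upward direction; opposite *)
(* directions have the same slope, and the half-open slope intervals make the numbering *)
(* invariant under rotation by a sixth of a turn, vertical directions being excluded. *)
Definition slope_class (m : R) : nat := ((- (Num.sqrt 3)^-1 < m)%R + ((Num.sqrt 3)^-1 < m)%R)%N.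
Definition sextant x y : nat := (3 * (0 < x)%R + slope_class (y / x))%N.

Lemma slope_class_le2 m : (slope_class m <= 2)%N.
Proof. by rewrite /slope_class; case: (_ < _); case: (_ < _). Qed.

Lemma slope_class_le m m' : m <= m' -> (slope_class m <= slope_class m')%N.
Proof.
move=> mm'; apply: leq_add.
  by case: ltP => // h; rewrite (lt_le_trans h).
by case: ltP => // h; rewrite (lt_le_trans h).
Qed.

Lemma sextant_opp x y : x != 0 -> sextant (- x) (- y) = sextant x y + 3 %[mod 6].
Proof.
move=> x0; rewrite /sextant invrN mulrNN oppr_gt0.
by case: (ltgtP x 0) x0 => //= _ _; move: (slope_class _) => s; lia.
Qed.

Lemma sextantE x y (p := Num.sqrt 3 * y) : x != 0 ->
  sextant x y = (if (0 < x)%R then 3 + (- x < p)%R + (x < p)%R else (p < - x)%R + (p < x)%R)%N.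
Proof.
have r0 : 0 < Num.sqrt 3 :> R by rewrite sqrtr_gt0; lra.
move=> x0; rewrite /sextant /slope_class; case: (ltgtP 0 x) x0 => //= x0 _.
  rewrite !ltr_pdivlMr // -!(ltr_pM2l r0 _ y) mulNr mulrN !mulrA divff ?gt_eqF // mul1r.
  by rewrite addnA.
by rewrite !ltr_ndivlMr // -!(ltr_pM2l r0 y) mulNr mulrN !mulrA divff ?gt_eqF // mul1r.
Qed.

(** A third of a turn moves every direction by two sextants. In terms of [p], that is sqrt 3 times
    the ordinate, all the comparisons are linear. *)
Lemma sextant_rot x1 y1 x2 y2 (r := Num.sqrt 3 : R) : x1 != 0 -> x2 != 0 ->
  x2 = - (x1 / 2) - r / 2 * y1 -> y2 = - (y1 / 2) + r / 2 * x1 ->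
  sextant x2 y2 = sextant x1 y1 + 2 %[mod 6].
Proof.
have rr : r ^+ 2 = 3 by rewrite sqr_sqrtr //; lra.
move=> x10 x20 x2E y2E; rewrite !sextantE // -/r; set p := r * y1; set p2 := r * y2.
have e1 : x2 = - (x1 / 2) - p / 2 by rewrite x2E /p; field.
have e2 : p2 = - (p / 2) + 3 / 2 * x1 by rewrite /p2 y2E -rr /p; field.
clearbody p p2; clear - e1 e2 x10 x20.
case: (ltgtP 0 x1) x10 => // h1 _; case: (ltgtP 0 x2) x20 => // h2 _;
repeat match goal with |- context[(?a < ?b)%R] => case: (ltP a b) => ? end;
by [] || (exfalso; lra).
Qed.

(** The norm of the third vector forces the scalar product of the first two to be -1/2. Their
    determinant [k] is then sqrt 3 / 2 up to sign, so the second is the first turned by a third of a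
    turn, one way or the other. *)
Lemma sextant_triangle x1 y1 x2 y2 x3 y3 :
  x1 != 0 -> x2 != 0 ->
  x1 ^+ 2 + y1 ^+ 2 = 1 -> x2 ^+ 2 + y2 ^+ 2 = 1 -> x3 ^+ 2 + y3 ^+ 2 = 1 ->
  x1 + x2 + x3 = 0 -> y1 + y2 + y3 = 0 ->
  sextant x2 y2 = sextant x1 y1 + 2 %[mod 6] \/ sextant x2 y2 = sextant x1 y1 + 4 %[mod 6].
Proof.
move=> x10 x20 u1 u2 u3 sx sy; set r : R := Num.sqrt 3.
have rr : r ^+ 2 = 3 by rewrite sqr_sqrtr //; lra.
have r0 : 0 < r by rewrite sqrtr_gt0; lra.
pose k := x1 * y2 - x2 * y1.
have dot : x1 * x2 + y1 * y2 = - (1 / 2).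
  have x3E : x3 = - (x1 + x2) by lra.
  have y3E : y3 = - (y1 + y2) by lra.
  by move: u3; rewrite x3E y3E; lra.
have kk : (k - r / 2) * (k + r / 2) = 0.
  transitivity ((x1 ^+ 2 + y1 ^+ 2) * (x2 ^+ 2 + y2 ^+ 2)
    - (x1 * x2 + y1 * y2) ^+ 2 - r ^+ 2 / 4).
    by rewrite /k; field.
  by rewrite u1 u2 dot rr; field.
have x2E : x2 = - (x1 / 2) - k * y1.
  transitivity ((x1 ^+ 2 + y1 ^+ 2) * x2); first by rewrite u1 mul1r.
  transitivity ((x1 * x2 + y1 * y2) * x1 - k * y1); first by rewrite /k; ring.
  by rewrite dot; field.
have y2E : y2 = - (y1 / 2) + k * x1.
  transitivity ((x1 ^+ 2 + y1 ^+ 2) * y2); first by rewrite u1 mul1r.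
  transitivity ((x1 * x2 + y1 * y2) * y1 + k * x1); first by rewrite /k; ring.
  by rewrite dot; field.
move/eqP: kk; rewrite mulf_eq0 => /orP[] /eqP kE; [left | right].
  by apply: sextant_rot => //; rewrite -/r; have <- : k = r / 2 by lra.
have {}kE : k = - (r / 2) by lra.
have : sextant x1 y1 = sextant x2 y2 + 2 %[mod 6]; last lia.
apply: sextant_rot => //; rewrite -/r.
  transitivity (x1 / 4 + r ^+ 2 / 4 * x1); first by rewrite rr; field.
  by rewrite x2E y2E kE; field.
transitivity (y1 / 4 + r ^+ 2 / 4 * y1); first by rewrite rr; field.
by rewrite x2E y2E kE; field.
Qed.

(** Unless v1 + v2 = 0, both v1 - v2 and v4 - v3 are orthogonal to v1 + v2 and have equal norms,
    hence agree up to sign. *)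
Lemma unit_quadrangle x1 y1 x2 y2 x3 y3 x4 y4 :
  x1 ^+ 2 + y1 ^+ 2 = 1 -> x2 ^+ 2 + y2 ^+ 2 = 1 ->
  x3 ^+ 2 + y3 ^+ 2 = 1 -> x4 ^+ 2 + y4 ^+ 2 = 1 ->
  x1 + x2 + x3 + x4 = 0 -> y1 + y2 + y3 + y4 = 0 ->
  [\/ x2 = - x1 /\ y2 = - y1, x3 = - x2 /\ y3 = - y2 | x3 = - x1 /\ y3 = - y1].
Proof.
move=> u1 u2 u3 u4 sx sy.
have sq0 (a b : R) : a ^+ 2 + b ^+ 2 = 0 -> a = 0 /\ b = 0.
  by move/eqP; rewrite paddr_eq0 ?sqr_ge0 // !sqrf_eq0 => /andP[/eqP-> /eqP->].
pose a := x1 + x2; pose b := y1 + y2.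
pose c := x1 - x2; pose d := y1 - y2.
pose c' := x4 - x3; pose d' := y4 - y3.
have [/sq0[a0 b0]|ab0] := eqVneq (a ^+ 2 + b ^+ 2) 0.
  by constructor 1; rewrite /a /b in a0 b0; split; lra.
have x4E : x4 = - (x1 + x2 + x3) by lra.
have y4E : y4 = - (y1 + y2 + y3) by lra.
have p1 : a * c + b * d = 0.
  transitivity ((x1 ^+ 2 + y1 ^+ 2) - (x2 ^+ 2 + y2 ^+ 2)); last by rewrite u1 u2 subrr.
  by rewrite /a /b /c /d; ring.
have p2 : a * c' + b * d' = 0.
  transitivity ((x3 ^+ 2 + y3 ^+ 2) - (x4 ^+ 2 + y4 ^+ 2)); last by rewrite u3 u4 subrr.
  by rewrite /a /b /c' /d' x4E y4E; ring.
have cross : c * d' - d * c' = 0.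
  apply: (mulfI ab0); rewrite mulr0.
  transitivity ((a * c + b * d) * (a * d' - b * c') - (a * c' + b * d') * (a * d - b * c)).
    by ring.
  by rewrite p1 p2 !mul0r subrr.
have norm : c ^+ 2 + d ^+ 2 = c' ^+ 2 + d' ^+ 2.
  have e1 : c ^+ 2 + d ^+ 2 = 4 - (a ^+ 2 + b ^+ 2) by rewrite /a /b /c /d; lra.
  have e2 : c' ^+ 2 + d' ^+ 2 = 4 - ((x3 + x4) ^+ 2 + (y3 + y4) ^+ 2) by rewrite /c' /d'; lra.
  have xs : x3 + x4 = - a by rewrite /a; lra.
  have ys : y3 + y4 = - b by rewrite /b; lra.
  by rewrite e1 e2 xs ys !sqrrN.
have : ((c - c') ^+ 2 + (d - d') ^+ 2) * ((c + c') ^+ 2 + (d + d') ^+ 2) = 0.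
  transitivity ((c ^+ 2 + d ^+ 2 - (c' ^+ 2 + d' ^+ 2)) ^+ 2 + 4 * (c * d' - d * c') ^+ 2).
    by ring.
  by rewrite norm cross subrr !expr0n /= mulr0 addr0.
move/eqP; rewrite mulf_eq0 => /orP[] /eqP /sq0[]; rewrite /c /d /c' /d' => h1 h2.
  by constructor 3; split; lra.
by constructor 2; split; lra.
Qed.

End Sextants.


(** Within a slab a bounded region is made of strips between consecutive edges, the upper edge
    counted positively and the lower one negatively. Every strip has both edges, because below and
    above all edges lies [face None]. *)
Lemma path_sum_ge0 (R : realDomainType) (D : Type) (C : eqType) (tw : D -> D)
    (face : option D -> C) (h : D -> R) (c : C) (s : seq D) :
  c != face None -> pairwise (fun d d' => h d < h d') s ->
  path (fun x y => face (omap tw y) == face x) None (rcons (map Some s) None) ->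
  0 <= \sum_(d <- s)
     ((face (Some (tw d)) == c)%:R - (face (Some d) == c)%:R) * h d.
Proof.
move=> cN; have main (s' : seq D) d0 : pairwise (fun d d' => h d < h d') (d0 :: s') ->
    path (fun x y => face (omap tw y) == face x) (Some d0) (rcons (map Some s') None) ->
    (face (Some d0) == c)%:R * h d0 <= \sum_(d <- s')
     ((face (Some (tw d)) == c)%:R - (face (Some d) == c)%:R) * h d.
  elim: s' d0 => [|d s' IHs] d0 /=.
    by move=> _ /andP[/eqP <- _]; rewrite eq_sym (negPf cN) mul0r big_nil.
  case/andP=> /andP[h0 _] ps /andP[/eqP f0 pf]; rewrite big_cons f0.
  have := IHs d ps pf; rewrite mulrBl.
  by case: (face (Some d0) == c); rewrite ?mul1r ?mul0r; lra.
case: s => [|d s]; first by rewrite big_nil.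
move=> ps /= /andP[/eqP f0 pf]; rewrite big_cons f0 eq_sym (negPf cN) sub0r mulNr.
by rewrite addrC subr_ge0 main.
Qed.

Lemma sum_ord_telescope (V : zmodType) n (a b : nat) (g : nat -> V) : (a <= b <= n)%N ->
  \sum_(v < n | (a <= v < b)%N) (g v.+1 - g v) = g b - g a.
Proof.
move=> /andP[ab bn]; rewrite -(telescope_sumr g ab).
by rewrite (big_nat_widenl _ 0%N) // (big_nat_widen _ _ n) // big_mkord.
Qed.

(** * Plane straight-line graphs *)

Section Plane.

Variables (R : realType) (n : nat) (e : rel 'I_n) (X Y : nat -> R).

Definition dart := {d : 'I_n * 'I_n | e d.1 d.2}.
HB.instance Definition _ := Finite.on dart.
Definition source (d : dart) := (val d).1.

Hypothesis e_sym : symmetric e.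

Lemma twin_proof (d : dart) : e (val d).2 (val d).1.
Proof. by rewrite e_sym (valP d). Qed.
Definition twin (d : dart) : dart := Sub ((val d).2, (val d).1) (twin_proof d).
Definition target d := source (twin d).
Definition rightward (d : dart) := (source d < target d)%N.

Definition slope (d : dart) := (Y (target d) - Y (source d)) / (X (target d) - X (source d)).
Definition height (d : dart) t := Y (source d) + slope d * (t - X (source d)).

Hypothesis X_lt : forall i j, (i < j < n)%N -> X i < X j.
Hypothesis e_irr : irreflexive e.
Hypothesis no_cross : forall (d d' : dart) (t : R),
  rightward d -> rightward d' -> d != d' ->
  X (source d) <= t <= X (target d) -> X (source d') <= t <= X (target d') ->
  height d t = height d' t ->
  exists w, [/\ w = source d \/ w = target d, w = source d' \/ w = target d' & t = X w].
Hypothesis not_isolated : forall v, exists w, e v w.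

Lemma dart_inj (d d' : dart) : source d = source d' -> target d = target d' -> d = d'.
Proof.
rewrite /target /source /= => h1 h2; apply: val_inj.
by rewrite [LHS]surjective_pairing h1 h2 -surjective_pairing.
Qed.

Lemma twinK : involutive twin.
Proof. by move=> d; apply: dart_inj. Qed.

Lemma target_twin d : target (twin d) = source d.
Proof. by rewrite /target twinK. Qed.

Lemma edge_dart u v : e u v -> exists d, source d = u /\ target d = v.
Proof. by move=> uv; exists (Sub (u, v) uv : dart). Qed.

Lemma no_loop d : source d != target d.
Proof.
have ed : e (source d) (target d) := valP d.
by apply/eqP => h; rewrite h e_irr in ed.
Qed.

Lemma right_twin d : rightward (twin d) = ~~ rightward d.
Proof.
rewrite /rightward target_twin -/(target d); case: ltngtP => // /val_inj h.
by have := no_loop d; rewrite h eqxx.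
Qed.

Lemma X_leq (i j : nat) : (i <= j)%N -> (j < n)%N -> X i <= X j.
Proof. by rewrite leq_eqVlt => /orP[/eqP->//|ij jn]; rewrite ltW // X_lt // ij. Qed.

Lemma X_inj (u v : 'I_n) : X u = X v -> u = v.
Proof.
move=> uv; apply: val_inj; apply/eqP; case: ltngtP => // h.
  by have := X_lt (i := u) (j := v); rewrite h ltn_ord uv ltxx => /(_ isT).
by have := X_lt (i := v) (j := u); rewrite h ltn_ord uv ltxx => /(_ isT).
Qed.

Lemma X_dart d : rightward d -> X (source d) < X (target d).
Proof. by move=> rd; apply: X_lt; rewrite ltn_ord andbT. Qed.

Lemma height_source d : height d (X (source d)) = Y (source d).
Proof. by rewrite /height subrr mulr0 addr0. Qed.

Lemma X_neq d : X (target d) - X (source d) != 0.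
Proof.
by rewrite subr_eq0; apply/eqP=> /X_inj h; have := no_loop d; rewrite h eqxx.
Qed.

Lemma height_target d : height d (X (target d)) = Y (target d).
Proof. by rewrite /height /slope mulfVK ?X_neq //; ring. Qed.

Lemma height_neq d d' t : rightward d -> rightward d' -> d != d' ->
  X (source d) < t < X (target d) -> X (source d') < t < X (target d') ->
  height d t != height d' t.
Proof.
move=> rd rd' dd' /andP[t1 t2] td'; apply/eqP => h.
have [||w [wd _ tw]] := no_cross rd rd' dd' _ _ h; rewrite ?(ltW t1) ?(ltW t2) //.
  by case/andP: td' => *; rewrite !ltW.
by case: wd => wE; move: t1 t2; rewrite tw wE ltxx.
Qed.

(** The difference of heights is affine: a change of sign between [t0] and [t] would make the edges
    meet at an abscissa interior to both. *)
Lemma height_lt d d' t0 t : rightward d -> rightward d' -> d != d' ->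
  X (source d) <= t0 <= X (target d) -> X (source d') <= t0 <= X (target d') ->
  X (source d) < t < X (target d) -> X (source d') < t < X (target d') ->
  height d t0 < height d' t0 -> height d t < height d' t.
Proof.
move=> rd rd' dd' /andP[a1 a2] /andP[b1 b2] td td' lt0.
case: (ltgtP (height d t)) => // [gt|eq]; last first.
  by have := height_neq rd rd' dd' td td'; rewrite eq eqxx.
case/andP: td td' => [c1 c2] /andP[e1 e2].
pose g z := height d' z - height d z.
have g0 : 0 < g t0 by rewrite subr_gt0.
have gt0 : g t < 0 by rewrite subr_lt0.
pose l := g t0 / (g t0 - g t).
have dg : 0 < g t0 - g t by lra.
have l0 : 0 < l by rewrite divr_gt0.
have l1 : l < 1 by rewrite ltr_pdivrMr // mul1r; lra.
pose z := t0 + l * (t - t0).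
have gz : g z = 0.
  have lE : l * (g t0 - g t) = g t0 by rewrite /l divfK // gt_eqF.
  transitivity (g t0 - l * (g t0 - g t)); last by rewrite lE subrr.
  by rewrite /g /z /height; ring.
have := @height_neq d d' z rd rd' dd'; rewrite eq_sym -subr_eq0 -/(g z) gz eqxx => h.
by suff: false by []; apply: h; rewrite /z; apply/andP; split; nra.
Qed.

Definition spans (v : 'I_n) (d : dart) := (source d < v < target d)%N.

Lemma spansP v d : spans v d -> X (source d) < X v < X (target d).
Proof. by case/andP=> h1 h2; rewrite !X_lt ?h1 ?h2 ?ltn_ord. Qed.

(** As [v] is not isolated, an edge passing through it would meet an edge incident to [v] away from
    its own endpoints. *)
Lemma height_spans v d : spans v d -> rightward d -> height d (X v) != Y v.
Proof.
move=> sd rd; have [w vw] := not_isolated v; have [d0 [t0 h0]] := edge_dart vw.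
have [d' rd' vd'] : exists2 d' : dart, rightward d' & v = source d' \/ v = target d'.
  have [r|r] := boolP (rightward d0); first by exists d0 => //; left.
  by exists (twin d0); rewrite ?right_twin // target_twin; right.
have hv : height d' (X v) = Y v by case: vd' => ->; rewrite ?height_source ?height_target.
rewrite -hv; apply/eqP => h; have /andP[s1 s2] := spansP sd.
have dd' : d != d'.
  by apply/eqP=> dd'; case/andP: sd; rewrite dd'; case: vd' => ->; rewrite ltnn.
have := X_dart rd' => x'.
have [||u [ud _ /X_inj vu]] := no_cross rd rd' dd' _ _ h.
- by rewrite !ltW.
- by case: vd' => ->; rewrite lexx ?ltW.
by case/andP: sd; rewrite vu; case: ud => ->; rewrite ltnn.
Qed.

(** * Edges met by the vertical line through a vertex *)

(** Just to the left of [v], a larger slope means a smaller height, hence the opposite key. *)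
Definition lefts (v : 'I_n) := sort (fun d d' => - slope d <= - slope d')
  [seq d <- enum {: dart} | rightward d && (target d == v)].
Definition rights (v : 'I_n) := sort (fun d d' => slope d <= slope d')
  [seq d <- enum {: dart} | rightward d && (source d == v)].
Definition belows (v : 'I_n) := sort (fun d d' => height d (X v) <= height d' (X v))
  [seq d <- enum {: dart} | [&& rightward d, spans v d & height d (X v) < Y v]].
Definition aboves (v : 'I_n) := sort (fun d d' => height d (X v) <= height d' (X v))
  [seq d <- enum {: dart} | [&& rightward d, spans v d & Y v < height d (X v)]].

Lemma mem_lefts v d : (d \in lefts v) = rightward d && (target d == v).
Proof. by rewrite mem_sort mem_filter mem_enum andbT. Qed.
Lemma mem_rights v d : (d \in rights v) = rightward d && (source d == v).
Proof. by rewrite mem_sort mem_filter mem_enum andbT. Qed.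
Lemma mem_belows v d :
  (d \in belows v) = [&& rightward d, spans v d & height d (X v) < Y v].
Proof. by rewrite mem_sort mem_filter mem_enum andbT. Qed.
Lemma mem_aboves v d :
  (d \in aboves v) = [&& rightward d, spans v d & Y v < height d (X v)].
Proof. by rewrite mem_sort mem_filter mem_enum andbT. Qed.

Definition under t : rel dart := fun d d' => height d t < height d' t.

Lemma under_trans t : transitive (under t).
Proof. by move=> d2 d1 d3; apply: lt_trans. Qed.

(** Serves both sides of [v]. The order at [v] persists at [t] by [height_lt], except among the
    edges of [s], which all meet at [v] and whose order is assumed. *)
Lemma slab_pairwise (v : 'I_n) (s : seq dart) (t : R) :
  (forall d, rightward d -> spans v d -> X (source d) < t < X (target d)) ->
  (forall d, d \in s -> [/\ rightward d, X (source d) <= X v <= X (target d),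
     X (source d) < t < X (target d) & height d (X v) = Y v]) ->
  pairwise (under t) s -> pairwise (under t) (belows v ++ s ++ aboves v).
Proof.
move=> spt s_v ps.
have xv d : spans v d -> X (source d) <= X v <= X (target d).
  by move/spansP/andP=> [h1 h2]; rewrite !ltW.
have lift d d' : rightward d -> spans v d -> rightward d' -> spans v d' -> d != d' ->
    height d (X v) <= height d' (X v) -> under t d d'.
  move=> rd sd rd' sd' dd' h.
  apply: (@height_lt d d' (X v) t) => //; rewrite ?xv ?spt // lt_neqAle h andbT.
  by apply: height_neq => //; apply: spansP.
rewrite !pairwise_cat ps /= allrel_catr; apply/and3P; split.
- apply/andP; split; apply/allrelP=> d d'.
    rewrite mem_belows => /and3P[rd sd hd] /s_v[rd' v' t' h'].
    apply: (@height_lt d d' (X v) t) => //; [|exact: xv|exact: spt|by rewrite h'].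
    by apply/eqP=> dd'; move: hd; rewrite dd' h' ltxx.
  rewrite mem_belows mem_aboves => /and3P[rd sd hd] /and3P[rd' sd' hd'].
  apply: lift => //; last by rewrite ltW // (lt_trans hd).
  by apply/eqP=> dd'; move: hd; rewrite dd' ltNge ltW.
- apply: sort_pairwise; first by rewrite filter_uniq ?enum_uniq.
  move=> d d'; rewrite !mem_filter => /andP[/and3P[rd sd _] _] /andP[/and3P[rd' sd' _] _].
  exact: lift.
apply/andP; split.
  apply/allrelP=> d d' /s_v[rd' v' t' h'].
  rewrite mem_aboves => /and3P[rd sd hd].
  apply: (@height_lt d d' (X v) t) => //; [|exact: xv|exact: spt|by rewrite h'].
  by apply/eqP=> dd'; move: hd; rewrite -dd' h' ltxx.
apply: sort_pairwise; first by rewrite filter_uniq ?enum_uniq.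
move=> d d'; rewrite !mem_filter => /andP[/and3P[rd sd _] _] /andP[/and3P[rd' sd' _] _].
exact: lift.
Qed.

Lemma mem_spans v d :
  (d \in belows v) || (d \in aboves v) = rightward d && spans v d.
Proof.
rewrite mem_belows mem_aboves; case rd: (rightward d) => //=; case sd: (spans v d) => //=.
by rewrite -neq_lt height_spans.
Qed.

Lemma mem_slab v d : (d \in belows v ++ rights v ++ aboves v) =
  rightward d && (source d <= v < target d)%N.
Proof.
rewrite !mem_cat orbCA mem_spans mem_rights; case rd: (rightward d) => //=.
move: rd; rewrite /rightward /spans -(inj_eq val_inj) /=; lia.
Qed.

Lemma mem_lslab v d : (d \in belows v ++ lefts v ++ aboves v) =
  rightward d && (source d < v <= target d)%N.
Proof.
rewrite !mem_cat orbCA mem_spans mem_lefts; case rd: (rightward d) => //=.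
move: rd; rewrite /rightward /spans -(inj_eq val_inj) /=; lia.
Qed.

Lemma slab_open (v : 'I_n) d t : X v < t < X v.+1 -> (source d <= v < target d)%N ->
  X (source d) < t < X (target d).
Proof.
move=> /andP[t1 t2] /andP[h1 h2]; apply/andP; split.
  by apply: le_lt_trans t1; apply: X_leq.
by apply: lt_le_trans t2 _; apply: X_leq.
Qed.

Lemma slab_under (v : 'I_n) t : X v < t < X v.+1 ->
  pairwise (under t) (belows v ++ rights v ++ aboves v).
Proof.
move=> tv; apply: slab_pairwise => [d rd /andP[h1 h2]|d|].
- by apply: slab_open tv _; rewrite h2 ltnW.
- rewrite mem_rights => /andP[rd /eqP tl]; have xd := X_dart rd; move: (rd).
  rewrite /rightward => lt; rewrite -tl lexx ltW //; split=> //.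
    by apply: slab_open tv _; rewrite -tl leqnn.
  by rewrite tl -tl height_source.
apply: sort_pairwise; first by rewrite filter_uniq ?enum_uniq.
move=> d d'; rewrite !mem_filter.
move=> /andP[/andP[rd /eqP tl] _] /andP[/andP[rd' /eqP tl'] _] dd' h.
have [lt lt'] : (source d < target d)%N /\ (source d' < target d')%N by [].
rewrite /under lt_neqAle height_neq //; first last.
- by apply: slab_open tv _; rewrite -tl' leqnn.
- by apply: slab_open tv _; rewrite -tl leqnn.
rewrite /height tl tl' lerD2l ler_wpM2r // subr_ge0 ltW //; by case/andP: tv.
Qed.

Lemma lslab_under (v w : 'I_n) t : w = v.+1 :> nat -> X v < t < X w ->
  pairwise (under t) (belows w ++ lefts w ++ aboves w).
Proof.
move=> wv; rewrite wv => tv; apply: slab_pairwise => [d rd /andP[h1 h2]|d|].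
- by apply: slab_open tv _; rewrite wv in h1 h2; rewrite -ltnS h1 ltnW.
- rewrite mem_lefts => /andP[rd /eqP hd]; have xd := X_dart rd; move: (rd).
  rewrite /rightward => lt; rewrite -hd lexx ltW //; split=> //.
    by apply: slab_open tv _; rewrite hd wv ltnS leqnn andbT -ltnS -wv -hd.
  by rewrite hd -hd height_target.
apply: sort_pairwise; first by rewrite filter_uniq ?enum_uniq.
move=> d d'; rewrite !mem_filter.
move=> /andP[/andP[rd /eqP hd] _] /andP[/andP[rd' /eqP hd'] _] dd' h.
have [lt lt'] : (source d < target d)%N /\ (source d' < target d')%N by [].
have ht (b : dart) : target b = w -> height b t = Y w - slope b * (X w - t).
  by move=> hb; rewrite -hb -height_target /height; ring.
rewrite /under lt_neqAle height_neq //; first last.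
- by apply: slab_open tv _; rewrite hd' wv ltnS leqnn andbT -ltnS -wv -hd'.
- by apply: slab_open tv _; rewrite hd wv ltnS leqnn andbT -ltnS -wv -hd.
rewrite !ht // lerD2l -[- (slope d * _)]mulNr -[- (slope d' * _)]mulNr ler_wpM2r //.
by rewrite wv subr_ge0 ltW //; case/andP: tv.
Qed.

Lemma slabS (v w : 'I_n) : w = v.+1 :> nat ->
  belows v ++ rights v ++ aboves v = belows w ++ lefts w ++ aboves w.
Proof.
(* Both lists are strictly sorted by height at the same abscissa [t] and have the same elements. *)
move=> wv; pose t := (X v + X w) / 2.
have xx : X v < X w by rewrite X_lt // wv ltnSn -wv ltn_ord.
have tv : X v < t < X w by rewrite /t; lra.
apply: (@irr_sorted_eq _ (under t)); first exact: under_trans.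
- by move=> d; rewrite /under ltxx.
- by rewrite (sorted_pairwise (@under_trans t)) slab_under // -wv.
- by rewrite (sorted_pairwise (@under_trans t)) (lslab_under wv).
by move=> d; rewrite mem_slab mem_lslab wv !ltnS.
Qed.

Lemma uniq_slab v : uniq (belows v ++ rights v ++ aboves v).
Proof.
rewrite !cat_uniq; apply/and3P; split; first by rewrite sort_uniq filter_uniq ?enum_uniq.
  apply/hasPn=> d; rewrite mem_cat => /orP[] /=.
    by rewrite mem_rights mem_belows /spans => /andP[rd /eqP <-]; rewrite ltnn /= andbF.
  by rewrite mem_aboves mem_belows => /and3P[rd sd hd]; rewrite ltNge (ltW hd) !andbF.
apply/and3P; split; try by rewrite sort_uniq filter_uniq ?enum_uniq.
apply/hasPn=> d /=; rewrite mem_aboves mem_rights => /and3P[rd /andP[h1 _] _].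
by apply/negP=> /andP[_ /eqP h]; move: h1; rewrite h ltnn.
Qed.

Lemma uniq_lefts v : uniq (lefts v).
Proof. by rewrite sort_uniq filter_uniq ?enum_uniq. Qed.

Lemma slab0 (v : 'I_n) : v = 0%N :> nat -> belows v ++ lefts v ++ aboves v = [::].
Proof.
move=> v0; case sE: (_ ++ _) => [//|d s].
by have := mem_head d s; rewrite -sE mem_lslab v0 ltn0 andbF.
Qed.

Lemma rightward_belows v : all rightward (belows v).
Proof. by apply/allP=> d; rewrite mem_belows => /and3P[]. Qed.

Lemma some_neighbour v : lefts v ++ rights v != [::].
Proof.
have [w vw] := not_isolated v; have [d [td hd]] := edge_dart vw.
have [rd|rd] := boolP (rightward d).
  suff: d \in lefts v ++ rights v by apply: contraTneq => ->.
  by rewrite mem_cat mem_rights rd td eqxx orbT.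
suff: twin d \in lefts v ++ rights v by apply: contraTneq => ->.
by rewrite mem_cat mem_lefts right_twin rd target_twin td eqxx.
Qed.

(** * Sextants of darts *)

Definition sector d := (3 * rightward d + slope_class (slope d))%N.

Lemma slope_twin d : slope (twin d) = slope d.
Proof.
by rewrite /slope target_twin -/(target d) -(opprB (Y _)) -(opprB (X _)) invrN mulrNN.
Qed.

Lemma sector_sextant d :
  sector d = sextant (X (target d) - X (source d)) (Y (target d) - Y (source d)).
Proof.
rewrite /sector /sextant; congr (3 * _ + _)%N; rewrite subr_gt0.
have [rd|rd] := boolP (rightward d); first by rewrite X_dart.
rewrite -right_twin in rd; have := X_dart rd; rewrite target_twin -/(target d) => h.
by rewrite ltNge ltW.
Qed.

Lemma sector_le5 d : (sector d <= 5)%N.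
Proof. by rewrite /sector; have := slope_class_le2 (slope d); case: (rightward d); lia. Qed.

Lemma sector_twin d : rightward d -> sector d = (sector (twin d) + 3)%N.
Proof. by move=> rd; rewrite /sector right_twin rd slope_twin /= addnC. Qed.

Local Notation cyc := (Sweep.cyc twin lefts rights).
Local Notation nxt := (Sweep.nxt twin source lefts rights).
Local Notation face := (Sweep.face twin source belows lefts rights aboves).

Lemma sector_sorted v : sorted leq (map sector (cyc v)).
Proof.
have tr : transitive (relpre sector leq) by move=> d2 d1 d3; apply: leq_trans.
rewrite sorted_map (sorted_pairwise tr) pairwise_cat -!(sorted_pairwise tr).
apply/and3P; split.
- apply/allrelP=> d d'; rewrite mem_rev => /mapP[b]; rewrite mem_lefts => /andP[rb _] ->.
  rewrite mem_rights => /andP[rd' _]; rewrite /sector /= right_twin rb rd' /=.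
  by have := slope_class_le2 (slope (twin b)); lia.
- rewrite rev_sorted sorted_map.
  apply: (@sub_in_sorted _ (mem (lefts v)) (fun d d' => - slope d <= - slope d')).
  + move=> d d' /=; rewrite !mem_lefts /sector !right_twin !slope_twin.
    move=> /andP[-> _] /andP[-> _].
    by rewrite lerN2 /=; apply: slope_class_le.
  + by apply/allP.
  by apply: sort_sorted => d d'; apply: le_total.
apply: (@sub_in_sorted _ (mem (rights v)) (fun d d' => slope d <= slope d')).
- move=> d d' /=; rewrite !mem_rights /sector => /andP[-> _] /andP[-> _] h.
  by rewrite leq_add2l slope_class_le.
- by apply/allP.
by apply: sort_sorted => d d'; apply: le_total.
Qed.

(** * Unit edges: short boundary walks and areas of regions *)

Hypothesis unit_length : forall d,
  (X (target d) - X (source d)) ^+ 2 + (Y (target d) - Y (source d)) ^+ 2 = 1.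

Let source_nxt d : source (nxt d) = target d :=
  Sweep.tl_nxt twinK right_twin mem_lefts mem_rights d.
Let nxt_inj : injective nxt :=
  Sweep.nxt_inj twinK right_twin mem_lefts mem_rights uniq_lefts uniq_slab.

Lemma twin_nxt d : X (target (nxt d)) - X (source (nxt d)) = - (X (target d) - X (source d)) ->
  nxt d = twin d.
Proof.
rewrite source_nxt opprB => /addIr /X_inj h; apply: dart_inj; first exact: source_nxt.
by rewrite target_twin.
Qed.

Lemma order3_sector d : order nxt d = 3 ->
  sector (nxt d) = sector d + 2 %[mod 6] \/ sector (nxt d) = sector d + 4 %[mod 6].
Proof.
move=> o; have := iter_order nxt_inj d; rewrite o /= => e3; rewrite !sector_sextant.
apply: sextant_triangle; rewrite ?X_neq ?unit_length //.
- exact: (unit_length (nxt (nxt d))).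
  by rewrite !source_nxt -(source_nxt (nxt (nxt d))) e3; ring.
by rewrite !source_nxt -(source_nxt (nxt (nxt d))) e3; ring.
Qed.

Lemma order4_sector d : order nxt d = 4 ->
  [\/ nxt d = twin d, nxt (nxt d) = twin (nxt d)
     | sector (nxt (nxt d)) = sector d + 3 %[mod 6]].
Proof.
move=> o; have := iter_order nxt_inj d; rewrite o /= => e4.
have := unit_quadrangle (unit_length d) (unit_length (nxt d)) (unit_length (nxt (nxt d)))
  (unit_length (nxt (nxt (nxt d)))).
rewrite !source_nxt -(source_nxt (nxt (nxt (nxt d)))) e4.
case; [by ring | by ring | | |]; rewrite -!source_nxt => -[hx hy].
- by constructor 1; apply: twin_nxt; rewrite !source_nxt in hx *.
- by constructor 2; apply: twin_nxt; rewrite !source_nxt in hx *.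
constructor 3; rewrite !sector_sextant !source_nxt in hx hy *.
by rewrite hx hy sextant_opp // X_neq.
Qed.

Let face_nxt d : face (Some (nxt d)) = face (Some d) :=
  Sweep.face_nxt twin source belows lefts rights aboves d.

(* The signed area between the dart and the axis of abscissas, counted so that a *)
(* counterclockwise closed walk gets a positive sum. *)
Definition trap d : R := (X (source d) - X (target d)) * (Y (source d) + Y (target d)) / 2.

Lemma trap_twin d : trap (twin d) = - trap d.
Proof. by rewrite /trap target_twin -/(target d); ring. Qed.

Lemma sum_trap : \sum_d trap d = 0.
Proof.
have : \sum_d trap d = - \sum_d trap d.
  rewrite {1}(reindex_inj (inv_inj twinK)) /= -sumrN.
  by apply: eq_bigr => d _; apply: trap_twin.
lra.
Qed.

Let order_gt1 d : (1 < order nxt d)%N :=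
  Sweep.order_gt1 twinK right_twin mem_lefts mem_rights uniq_lefts uniq_slab no_loop d.

Lemma orbit_trap d : - \sum_(j < order nxt d) trap (iter j nxt d) <
  (order nxt d)%:R ^+ 2 / (4 * pi).
Proof.
pose x z j := z (source (iter j nxt d)) : R.
have stepE (z : nat -> R) j : x z j.+1 = z (target (iter j nxt d)).
  by rewrite /x /= source_nxt.
have closed z : x z (order nxt d) = x z 0%N by rewrite /x (iter_order nxt_inj).
have := isoperimetric (order_gt1 d) (closed X) (closed Y).
rewrite -sumrN => iso; rewrite (eq_bigr (fun j : 'I_(order nxt d) =>
  (x X j.+1 - x X j) * (x Y j + x Y j.+1) / 2)); last first.
  by move=> j _; rewrite /trap !stepE /x; field.
by apply: iso => j; rewrite !stepE /x unit_length.
Qed.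

Local Notation fcard := (Sweep.fcard twin source belows lefts rights aboves).
Local Notation outer := (face None).

(** The outer boundary may consist of several closed walks. One of length o <= L has mean of -[trap]
    below o / (4 pi) <= L / (4 pi), and there are L darts to sum over. *)
Lemma outer_trap : (0 < fcard outer)%N ->
  - \sum_(d | face (Some d) == outer) trap d < (fcard outer)%:R ^+ 2 / (4 * pi).
Proof.
move=> f0; set L := fcard outer; have pi0 := pi_gt0 R.
rewrite (orbit_average trap nxt_inj) => [|d]; last by rewrite face_nxt.
have -> : L%:R ^+ 2 / (4 * pi) = \sum_(d | face (Some d) == outer) L%:R / (4 * pi) :> R.
  transitivity (L%:R * (L%:R / (4 * pi)) : R); first by rewrite mulrA.
  rewrite {1}/L Sweep.fcardE natr_sum mulr_suml; apply: eq_bigr => d _; exact: mul1r.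
rewrite -sumrN -subr_gt0 -sumrB.
have pos d : face (Some d) == outer -> 0 < L%:R / (4 * pi) -
    - ((\sum_(j < order nxt d) trap (iter j nxt d)) / (order nxt d)%:R).
  move=> fd; have o0 : 0 < (order nxt d)%:R :> R by rewrite ltr0n order_gt0.
  have oL : (order nxt d)%:R <= L%:R :> R.
    by rewrite ler_nat /L -(eqP fd) Sweep.order_le_fcard.
  rewrite subr_gt0 -mulNr ltr_pdivrMr //; apply: lt_le_trans (orbit_trap d) _.
  rewrite expr2 mulrAC ler_pM2r // ler_wpM2r // invr_ge0 mulr_ge0 // ltW //.
have [d0 fd0] : exists d0, face (Some d0) == outer.
  by move: f0; rewrite card_gt0 => /set0Pn[d0]; rewrite inE; exists d0.
rewrite (bigD1 d0) //= ltr_wpDr ?pos //; apply: sumr_ge0 => d /andP[fd _].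
exact/ltW/pos.
Qed.

(** The region is a single closed walk of three unit steps, whose signed area is sqrt 3 / 4 up to
    sign; the hypothesis settles the sign. *)
Lemma triangle_trap c : Sweep.triangle twin rightward source belows lefts rights aboves c ->
  0 <= \sum_(d | face (Some d) == c) trap d ->
  \sum_(d | face (Some d) == c) trap d = Num.sqrt 3 / 4.
Proof.
move=> tc; have /and3P[_ /eqP f3 _] := tc.
have [d0 /eqP fd0] : exists d0, face (Some d0) == c.
  have : (0 < fcard c)%N by rewrite f3.
  by rewrite card_gt0 => /set0Pn[d0]; rewrite inE; exists d0.
have o3 : order nxt d0 = 3.
  apply: (Sweep.triangle_order twinK right_twin mem_lefts mem_rights uniq_lefts uniq_slab
    some_neighbour dart_inj no_loop sector_le5 sector_twin sector_sorted).
  by rewrite fd0.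
have -> : \sum_(d | face (Some d) == c) trap d = \sum_(j < order nxt d0) trap (iter j nxt d0).
  rewrite (orbit_sum nxt trap); apply: eq_bigl => d.
  have /subset_cardP eqi : #|fconnect nxt d0| = #|[set d | face (Some d) == c]|.
    exact: etrans o3 (esym f3).
  transitivity (d \in [set d | face (Some d) == c]); first by rewrite inE.
  apply/esym; move: d; apply/eqi; apply/subsetP=> d /iter_findex <-.
  by rewrite inE; elim: (findex nxt d0 d) => [|k IHk] /=; rewrite ?fd0 // face_nxt.
rewrite o3 !big_ord_recr big_ord0 /= add0r.
have := iter_order nxt_inj d0; rewrite o3 /= => e3.
have := unit_length d0; have := unit_length (nxt d0); have := unit_length (nxt (nxt d0)).
rewrite /trap -!source_nxt e3.
move: (X (source d0)) (Y (source d0)) (X (source (nxt d0))) (Y (source (nxt d0)))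
  (X (source (nxt (nxt d0)))) (Y (source (nxt (nxt d0)))) => x1 y1 x2 y2 x3 y3 u3 u2 u1.
set T := _ + _; move=> T0; set r : R := Num.sqrt 3.
have rr : r ^+ 2 = 3 by rewrite sqr_sqrtr //; lra.
have r0 : 0 < r by rewrite sqrtr_gt0; lra.
have dot : (x2 - x1) * (x3 - x2) + (y2 - y1) * (y3 - y2) = - (1 / 2) by lra.
have : (T - r / 4) * (T + r / 4) = 0.
  transitivity ((((x2 - x1) ^+ 2 + (y2 - y1) ^+ 2) * ((x3 - x2) ^+ 2 + (y3 - y2) ^+ 2)
    - ((x2 - x1) * (x3 - x2) + (y2 - y1) * (y3 - y2)) ^+ 2) / 4 - r ^+ 2 / 16).
    by rewrite /T; field.
  by rewrite u1 u2 dot rr; field.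
by move/eqP; rewrite mulf_eq0 => /orP[] /eqP; lra.
Qed.

(** [g] is a primitive of the height, and an affine function integrates over a slab to the width
    times its value at the midpoint. *)
Lemma trap_slabs d : rightward d -> - trap d =
  \sum_(v < n | (source d <= v < target d)%N)
     (X v.+1 - X v) * height d ((X v + X v.+1) / 2).
Proof.
move=> rd; pose g i :=
  Y (source d) * (X i - X (source d)) + slope d * (X i - X (source d)) ^+ 2 / 2.
rewrite (eq_bigr (fun v : 'I_n => g v.+1 - g v)); last by move=> v _; rewrite /g /height; field.
have -> : - trap d = g (target d) - g (source d).
  by rewrite /g /trap /slope; field; exact: X_neq.
by rewrite sum_ord_telescope // (ltnW rd) ltnW.
Qed.

(** On rightward darts [chi] is 1 for an edge with the region only below it and -1 for one with the
    region only above it. Cutting the areas along the slabs leaves [path_sum_ge0] in each of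
    them. *)
Lemma face_trap_ge0 c : c != outer -> 0 <= \sum_(d | face (Some d) == c) trap d.
Proof.
move=> cN; pose chi d : R := (face (Some (twin d)) == c)%:R - (face (Some d) == c)%:R.
have -> : \sum_(d | face (Some d) == c) trap d = \sum_(d | rightward d) chi d * - trap d.
  rewrite (bigID rightward) /= [X in _ + X](reindex_inj (inv_inj twinK)) /=.
  rewrite (eq_bigl (fun d => rightward d && (face (Some d) == c))) => [|d]; last exact: andbC.
  rewrite [X in _ + X](eq_bigl
    (fun d => rightward d && (face (Some (twin d)) == c))); last first.
    by move=> d; rewrite right_twin negbK andbC.
  rewrite !big_mkcondr -big_split; apply: eq_bigr => d rd /=; rewrite trap_twin /chi.
  by case: (face (Some d) == c); case: (face (Some (twin d)) == c); rewrite /=; lra.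
have -> : \sum_(d | rightward d) chi d * - trap d = \sum_(v < n) (X v.+1 - X v) *
    \sum_(d <- belows v ++ rights v ++ aboves v) chi d * height d ((X v + X v.+1) / 2).
  rewrite (eq_bigr _ (fun d rd => congr1 (fun z => chi d * z) (trap_slabs rd))).
  under eq_bigr => d rd do rewrite mulr_sumr.
  rewrite (exchange_big_dep xpredT) //=; apply: eq_bigr => v _.
  rewrite [RHS]mulr_sumr [RHS]big_uniq ?uniq_slab //= [RHS](eq_bigl _ _ (mem_slab v)).
  by apply: eq_bigr => d _; rewrite mulrCA.
apply: sumr_ge0 => v _; have [vn|vn] := ltnP v.+1 n; last first.
  rewrite big_seq big1 ?mulr0 // => d; rewrite mem_slab => /andP[_ /andP[_ h]].
  by have := leq_ltn_trans h (ltn_ord (target d)); rewrite ltnNge vn.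
have xx : X v < X v.+1 by rewrite X_lt // ltnSn.
apply: mulr_ge0; first by rewrite subr_ge0 ltW.
apply: (path_sum_ge0 (h := fun d => height d ((X v + X v.+1) / 2)) cN _
  (Sweep.face_slab source belows lefts rights aboves twinK v)).
by apply: slab_under; lra.
Qed.

Lemma outer_gt0 : (0 < n)%N -> (0 < fcard outer)%N.
Proof.
move=> n0; pose v0 := Ordinal n0.
have := Sweep.face_slab source belows lefts rights aboves twinK v0; rewrite /Sweep.slab.
case sE: (belows v0 ++ rights v0 ++ aboves v0) => [|d s] /=.
  have := some_neighbour v0; move/eqP: (slab0 (v := v0) erefl); move/eqP: sE.
  by rewrite -!size_eq0 !size_cat !addn_eq0 => /and3P[_ /eqP-> _] /and3P[_ /eqP-> _].
case/andP=> fd _; rewrite card_gt0; apply/set0Pn; exists (twin d).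
by rewrite inE.
Qed.

Lemma plane_bounds (S := (\sum_v (5 - Sweep.deg source v))%N) : (0 < n)%N -> exists t L : nat,
  [/\ (0 < L <= S)%N, (n + L <= t + S)%N & t%:R * (Num.sqrt 3 / 4) < L%:R ^+ 2 / (4 * pi) :> R].
Proof.
move=> n0; pose tri c := Sweep.triangle twin rightward source belows lefts rights aboves c.
exists #|[set c | tri c]|, (fcard outer); split.
- rewrite outer_gt0 //; exact: (Sweep.outer_le_deficit twinK right_twin mem_lefts mem_rights
    rightward_belows uniq_lefts uniq_slab slab0 slabS some_neighbour dart_inj no_loop
    sector_le5 sector_twin sector_sorted order3_sector order4_sector).
- exact: (Sweep.many_triangles twinK right_twin mem_lefts mem_rights
    rightward_belows uniq_lefts uniq_slab slab0 slabS some_neighbour dart_inj no_loop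
    sector_le5 sector_twin sector_sorted).
(* As [trap] sums to 0 over all darts, minus the outer sum is the total over the bounded regions,
   all nonnegative. *)
apply: le_lt_trans (outer_trap (outer_gt0 n0)).
have := sum_trap; rewrite (partition_big (fun d => face (Some d)) xpredT) //=.
rewrite (bigD1 outer) //= => /eqP; rewrite addrC addr_eq0 => /eqP <-.
have -> : #|[set c | tri c]|%:R * (Num.sqrt 3 / 4) = \sum_(c | tri c) Num.sqrt 3 / 4 :> R.
  by rewrite -sum1dep_card natr_sum mulr_suml; apply: eq_bigr => c _; rewrite mul1r.
rewrite [leRHS](bigID tri) /= -[leLHS]addr0; apply: lerD; last first.
  by apply: sumr_ge0 => c /andP[cN _]; apply: face_trap_ge0.
rewrite (eq_bigl (fun c => (c != outer) && tri c)) => [|c]; last first.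
  by rewrite andb_idl // => /and3P[].
by apply: ler_sum => c /andP[cN tc]; rewrite triangle_trap // face_trap_ge0.
Qed.

End Plane.

(** * Numerical conclusion *)

Lemma deficit_lower_bound (n : nat) (f : 'I_n -> nat) :
  (forall v, f v < n)%N -> (n * (6 - n) <= \sum_v (5 - f v))%N.
Proof.
move=> fn; rewrite -{1}(card_ord n) -sum_nat_const; apply: leq_sum => v _.
by have := fn v; lia.
Qed.

(** Here l <= 2 and s <= 5, so t = 0 or t <= 1 according to l, which forces n <= 4; but n (6 - n) >=
    8 for n = 2, 3, 4. *)
Lemma small_deficit (n t l s : nat) : (1 < n)%N -> (n * (6 - n) <= s)%N ->
  (0 < l < s)%N -> (n + l <= t + s)%N -> (s + l <= 6)%N -> (3 * t < l ^ 2)%N -> False.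
Proof.
move=> n1 small ls nlts sl bound.
have [l1|l2] : l = 1%N \/ l = 2%N by lia.
  have n4 : (n <= 4)%N by rewrite l1 in nlts bound sl; lia.
  by move: n n1 small n4 {nlts} => [|[|[|[|[|n]]]]] //=; lia.
have n4 : (n <= 4)%N by rewrite l2 in nlts bound sl; lia.
by move: n n1 small n4 {nlts} => [|[|[|[|[|n]]]]] //=; lia.
Qed.

Lemma deficit_bound (R : realType) (n t l s : nat) :
  (1 < n)%N -> (n * (6 - n) <= s)%N -> (0 < l <= s)%N -> (n + l <= t + s)%N ->
  t%:R * (Num.sqrt 3 / 4) < l%:R ^+ 2 / (4 * pi) :> R ->
  Num.sqrt (pi * Num.sqrt 3 * n%:R) < s%:R :> R.
Proof.
move=> n1 small /andP[l0 ls] nlts bound.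
have pi2 : 2 <= pi :> R := pi_ge2 R.
have pi4 : pi < 4 :> R by have := pihalf_lt2 R; lra.
set r := Num.sqrt 3 in bound *.
have rr : r ^+ 2 = 3 by rewrite sqr_sqrtr //; lra.
have r0 : 0 <= r by rewrite sqrtr_ge0.
have r1 : 17 / 10 < r by nra.
have r2 : r < 7 / 4 by nra.
set c := pi * r.
have c1 : 34 / 10 < c by rewrite /c; nra.
have c2 : c < 7 by rewrite /c; nra.
have {}bound : c * t%:R < l%:R ^+ 2.
  move: bound; rewrite ltr_pdivlMr ?mulr_gt0 //; last by lra.
  by rewrite /c; lra.
have s0 : 0 < s%:R :> R by rewrite ltr0n (leq_trans l0).
have lsR : l%:R <= s%:R :> R by rewrite ler_nat.
have nltsR : n%:R + l%:R <= t%:R + s%:R :> R by rewrite -!natrD ler_nat.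
have le_cn : c * n%:R < l%:R ^+ 2 + c * (s%:R - l%:R) by nra.
rewrite -[ltRHS]ger0_norm ?ltW // -sqrtr_sqr ltr_sqrt ?exprn_gt0 // -/c.
apply: lt_le_trans le_cn _; rewrite -subr_ge0.
have -> : s%:R ^+ 2 - (l%:R ^+ 2 + c * (s%:R - l%:R)) = (s%:R - l%:R) * (s%:R + l%:R - c) :> R.
  by ring.
(* Since c < 7, the product is nonnegative if s + l >= 7, or if s = l. *)
case: (ltnP 6 (s + l)) => sl.
  rewrite mulr_ge0 ?subr_ge0 //; have : 7 <= (s + l)%:R :> R by rewrite (ler_nat R 7).
  by rewrite natrD; lra.
move: (ls); rewrite leq_eqVlt => /orP[/eqP->|ls']; first by rewrite subrr mul0r.
have bound3 : (3 * t < l ^ 2)%N.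
  by rewrite -(ltr_nat R) natrM natrX; have : 0 <= t%:R :> R by []; nra.
by case: (small_deficit n1 small _ nlts sl bound3); rewrite l0.
Qed.

(** * Rotation of the given drawing to generic position *)

Section Rotation.

Variables (R : realType) (T : finType) (e : rel T) (p : T -> 'rV[R]_2).
Hypothesis hG : matchstick_graph e p.

Lemma generic_direction : exists a b : R, a ^+ 2 + b ^+ 2 = 1 /\
  injective (fun u => a * p u 0 0 + b * p u 0 1).
Proof.
pose x u := p u 0 0; pose y u := p u 0 1.
pose q (w : T * T) := `|(x w.1 - x w.2) / (y w.1 - y w.2)|.
(* [s] exceeds every quotient |dx / dy|, so x + s y cannot agree at two points with dy nonzero; if
   dy = 0, agreement forces dx = 0. *)
pose s := 1 + \sum_w q w.
have inj u v : x u + s * y u = x v + s * y v -> u = v.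
  move=> h; apply: (matchstick_inj hG); apply/rowP => i.
  have [y0|y0] := eqVneq (y u - y v) 0.
    have yE : y u = y v by lra.
    have xE : x u = x v by rewrite yE in h; lra.
    by case: i => -[|[|//]] hi; [rewrite (_ : Ordinal hi = 0) | rewrite (_ : Ordinal hi = 1)];
      rewrite -/(x u) -/(x v) -/(y u) -/(y v) //; apply: val_inj.
  have sE : s = - ((x u - x v) / (y u - y v)).
    by apply: (mulIf y0); rewrite mulNr divfK //; lra.
  have qs : q (u, v) < s.
    rewrite /s (bigD1 (u, v)) //= ltr_pwDl // lerDl.
    by apply: sumr_ge0 => w _; apply: normr_ge0.
  by have := ler_norm s; rewrite {2}sE normrN => h'; have := le_lt_trans h' qs; rewrite ltxx.
have n0 : 0 < 1 + s ^+ 2 by rewrite ltr_wpDr // sqr_ge0.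
set r := Num.sqrt (1 + s ^+ 2).
have r0 : r != 0 by rewrite gt_eqF // sqrtr_gt0.
exists (1 / r), (s / r); split.
  rewrite !expr_div_n -mulrDl expr1n -[X in X / _](@sqr_sqrtr _ (1 + s ^+ 2)) ?ltW //.
  by rewrite divff // sqrf_eq0.
move=> u v /= h; apply: inj.
have rE w : x w + s * y w = r * (1 / r * x w + s / r * y w) by field.
by rewrite !rE /x /y h.
Qed.

End Rotation.

Lemma sum_deficit (T : finType) (e : rel T) : (forall v, degree e v <> 0%N) ->
  (\sum_v (5 - degree e v) = 4 * ndeg e 1 + 3 * ndeg e 2 + 2 * ndeg e 3 + ndeg e 4)%N.
Proof.
move=> deg0; have nE i : ndeg e i = (\sum_v (degree e v == i))%N.
  by rewrite /ndeg -sum1dep_card big_mkcond.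
rewrite !nE !big_distrr -!big_split; apply: eq_bigr => v _ /=.
by move: (degree e v) (deg0 v) => [|[|[|[|[|[|k]]]]]].
Qed.

Lemma row2P (R : Type) (u v : 'rV[R]_2) : u 0 0 = v 0 0 -> u 0 1 = v 0 1 -> u = v.
Proof.
move=> h0 h1; apply/rowP=> -[[|[|//]] hi].
  by rewrite (_ : Ordinal hi = 0) //; apply: val_inj.
by rewrite (_ : Ordinal hi = 1) //; apply: val_inj.
Qed.

Lemma edist_eq1 (R : realType) (u v : 'rV[R]_2) :
  edist u v = 1 -> (u 0 0 - v 0 0) ^+ 2 + (u 0 1 - v 0 1) ^+ 2 = 1.
Proof.
rewrite /edist !big_ord_recl big_ord0 addr0 => uv.
have -> : (1 : 'I_2) = lift ord0 ord0 by apply: val_inj.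
by rewrite -[LHS]sqr_sqrtr ?addr_ge0 ?sqr_ge0 // uv expr1n.
Qed.

Theorem theorem1 (R : realType) (T : finType) (e : rel T) (p : T -> 'rV[R]_2)
    (hG : matchstick_graph e p)
    (hn : (1 <= #|T|)%N)
    (hiso : forall v : T, degree e v <> 0%N) :
  (4 * ndeg e 1 + 3 * ndeg e 2 + 2 * ndeg e 3 + ndeg e 4)%N%:R
    > Num.sqrt (pi * Num.sqrt 3 * #|T|%:R) :> R.
Proof.
have [[e_sym e_irr] p_inj unit_e cross] := hG.
have [a [b [ab inj_ab]]] := generic_direction hG.
pose X' u := a * p u 0 0 + b * p u 0 1; pose Y' u := a * p u 0 1 - b * p u 0 0.
have [t0 _] := card_gt0P hn.
pose vs := sort (fun u v => X' u <= X' v) (enum T).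
pose f (i : nat) := nth t0 vs i; pose X i := X' (f i); pose Y i := Y' (f i).
have size_vs : size vs = #|T| by rewrite size_sort cardE.
have f_inj : injective (fun i : 'I_#|T| => f i).
  move=> i j /eqP; rewrite nth_uniq ?size_vs // ?sort_uniq ?enum_uniq // => /eqP.
  exact: val_inj.
have f_bij : bijective (fun i : 'I_#|T| => f i) by apply: inj_card_bij; rewrite ?card_ord.
have X_lt i j : (i < j < #|T|)%N -> X i < X j.
  move=> /andP[ij jn]; have : pairwise (fun u v => X' u < X' v) vs.
    apply: sort_pairwise; rewrite ?enum_uniq // => u v _ _ uv le_uv.
    by rewrite lt_neqAle le_uv andbT; apply: contraNneq uv => /inj_ab ->.
  by move/(pairwiseP t0) => H; apply: H => //; rewrite inE size_vs // (ltn_trans ij).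
pose e' : rel 'I_#|T| := fun i j => e (f i) (f j).
have e'_sym : symmetric e' by move=> i j; apply: e_sym.
have e'_irr : irreflexive e' by move=> i; apply: e_irr.
have degE i : #|[set j | e' i j]| = degree e (f i).
  rewrite /degree -(card_imset _ f_inj); apply: eq_card => v; rewrite [RHS]inE.
  apply/imsetP/idP => [[j + ->]|fv]; first by rewrite inE.
  by have [g gK fK] := f_bij; exists (g v); rewrite ?inE /e' ?[f (g v)]fK.
have not_isolated i : exists j, e' i j.
  have := hiso (f i); rewrite -degE => /eqP; rewrite -lt0n card_gt0 => /set0Pn[j].
  by rewrite inE; exists j.
have unit' (d : dart e') :
    (X (target e'_sym d) - X (source d)) ^+ 2 + (Y (target e'_sym d) - Y (source d)) ^+ 2 = 1.
  have := edist_eq1 (unit_e _ _ (valP d : e (f (source d)) (f (target e'_sym d)))) => u1.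
  transitivity ((a ^+ 2 + b ^+ 2) * ((p (f (source d)) 0 0 - p (f (target e'_sym d)) 0 0) ^+ 2 +
    (p (f (source d)) 0 1 - p (f (target e'_sym d)) 0 1) ^+ 2)); last by rewrite ab u1 mulr1.
  by rewrite /X /Y /X' /Y'; ring.
have no_cross (d d' : dart e') (t : R) :
    rightward e'_sym d -> rightward e'_sym d' -> d != d' ->
    X (source d) <= t <= X (target e'_sym d) -> X (source d') <= t <= X (target e'_sym d') ->
    height X Y e'_sym d t = height X Y e'_sym d' t ->
    exists w, [/\ w = source d \/ w = target e'_sym d,
                  w = source d' \/ w = target e'_sym d' & t = X w].
  move=> rd rd' dd' td td' h; set H := height _ _ _ d t in h.
  (* The point with rotated coordinates (t, H), written in the original ones. *)
  pose z : 'rV[R]_2 := \row_i if i == 0 then a * t - b * H else b * t + a * H.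
  have in_seg c : rightward e'_sym c -> X (source c) <= t <= X (target e'_sym c) ->
      H = height X Y e'_sym c t -> in_segment (p (f (source c))) (p (f (target e'_sym c))) z.
    move=> rc /andP[tc1 tc2] Hc; have xc := X_dart X_lt rc.
    have x0 : 0 < X (target e'_sym c) - X (source c) by rewrite subr_gt0.
    pose l := (t - X (source c)) / (X (target e'_sym c) - X (source c)).
    exists l; split.
      apply/andP; split; last by rewrite /l ler_pdivrMr // mul1r lerD2r.
      by rewrite /l divr_ge0 ?subr_ge0 // ltW.
    have tE : t = (1 - l) * X (source c) + l * X (target e'_sym c).
      by rewrite /l; field; rewrite gt_eqF.
    have HE : H = (1 - l) * Y (source c) + l * Y (target e'_sym c).
      by rewrite Hc /height /slope /l; field; rewrite gt_eqF.
    clearbody l; apply: row2P; rewrite !mxE /= tE HE /X /Y /X' /Y'.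
      transitivity ((a ^+ 2 + b ^+ 2) *
        ((1 - l) * p (f (source c)) 0 0 + l * p (f (target e'_sym c)) 0 0)); first by ring.
      by rewrite ab mul1r.
    transitivity ((a ^+ 2 + b ^+ 2) *
      ((1 - l) * p (f (source c)) 0 1 + l * p (f (target e'_sym c)) 0 1)); first by ring.
    by rewrite ab mul1r.
  have ne : [set f (source d); f (target e'_sym d)] !=
      [set f (source d'); f (target e'_sym d')].
    apply: contra_neq dd' => eq_set.
    have : f (source d) \in [set f (source d'); f (target e'_sym d')] by rewrite -eq_set set21.
    have : f (target e'_sym d) \in [set f (source d'); f (target e'_sym d')].
      by rewrite -eq_set set22.
    rewrite !inE => /orP[] /eqP/f_inj hh /orP[] /eqP/f_inj ht.
    - by move: rd; rewrite /rightward hh ht ltnn.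
    - by move: rd rd'; rewrite /rightward hh ht => /ltnW; rewrite leqNgt => /negP.
    - exact: (dart_inj (e_sym := e'_sym)).
    - by move: rd; rewrite /rightward hh ht ltnn.
  have [w] := cross _ _ _ _ z (valP d : e (f (source d)) (f (target e'_sym d)))
    (valP d' : e (f (source d')) (f (target e'_sym d'))) ne
    (in_seg d rd td erefl) (in_seg d' rd' td' h).
  rewrite !inE => /andP[wd wd'] zw.
  have tw : t = X' w.
    rewrite /X' -zw !mxE /=; transitivity ((a ^+ 2 + b ^+ 2) * t); last by ring.
    by rewrite ab mul1r.
  have [i wi] : exists i : 'I_#|T|, w = f i.
    by case/orP: wd => /eqP ->; eexists.
  exists i; split; last by rewrite tw wi.
    by case/orP: wd; rewrite wi => /eqP/f_inj; [left | right].
  by case/orP: wd'; rewrite wi => /eqP/f_inj; [left | right].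
have degC i : Sweep.deg (@source _ e') i = degree e (f i).
  rewrite -degE /Sweep.deg -(card_in_imset (f := target e'_sym) (D := [set d | source d == i])).
    apply: eq_card => j; rewrite [RHS]inE; apply/imsetP/idP => [[d + ->]|ij].
      by rewrite inE => /eqP <-; apply: (valP d).
    have [d [td hd]] := edge_dart e'_sym ij.
    by exists d; rewrite ?inE ?td.
  move=> d d'; rewrite !inE => /eqP td /eqP td' hd.
  by apply: (dart_inj (e_sym := e'_sym)) => //; rewrite td.
have [t [l [ls nlts bound]]] := plane_bounds X_lt e'_irr no_cross not_isolated unit' hn.
have deg_lt v : (degree e v < #|T|)%N.
  rewrite /degree -cardsT; apply: proper_card; apply/properP; split; first exact: subsetT.
  by exists v; rewrite !inE // e_irr.
have n1 : (1 < #|T|)%N by apply: leq_ltn_trans (deg_lt t0); rewrite lt0n; apply/eqP.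
have sumE : (\sum_v (5 - degree e v) = \sum_i (5 - Sweep.deg (@source _ e') i))%N.
  by rewrite (reindex _ (onW_bij _ f_bij)) /=; apply: eq_bigr => i _; rewrite degC.
rewrite -sum_deficit // sumE; apply: deficit_bound n1 _ ls nlts bound.
by apply: deficit_lower_bound => i; rewrite degC.
Qed.
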